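(* Consider the $m$-dimensional Nicholson system $$y_i'(t)=-\widetilde d_i(t)\,y_i(t)+\sum_{j=1}^m\widetilde a_{ij}(t)\,y_j(t)+\widetilde\beta_i(t)\,y_i(t-r_i)\,e^{-\widetilde c_i(t)\,y_i(t-r_i)},\quad t\ge0,\ i=1,\dots,m,$$ with delays $r_i>0$, and assume: (a1) $\widetilde d_i,\widetilde a_{ij},\widetilde c_i,\widetilde\beta_i$ are almost periodic maps on $\mathbb{R}$; (a2) $\widetilde d_i(t)\ge d_0>0$ for all $t\in\mathbb{R}$ and all $i$; (a3) all $\widetilde a_{ij}$ are nonnegative and $\widetilde a_{ii}\equiv0$; (a4) $\widetilde\beta_i(t)>0$ for all $t\in\mathbb{R}$ and all $i$; (a5) $\widetilde c_i(t)\ge c_0>0$ for all $t\in\mathbb{R}$ and all $i$; (a6) $\widetilde d_i(t)-\sum_{j=1}^m\widetilde a_{ji}(t)>0$ for all $t\in\mathbb{R}$ and all $i$. Let $d_i^+=\sup_{t\in\mathbb{R}}\widetilde d_i(t)$, $\beta_i^+=\sup_{t\in\mathbb{R}}\widetilde\beta_i(t)$, and let $B$ be the diagonal matrix with diagonal elements $-\mu_1,\dots,-\mu_m$, where $$\mu_i=\frac1{r_i}\ln\left(\frac{e^2}{r_i\,\beta_i^+}\right),\quad 1\le i\le m.$$ (i) Whenever $r_i\,\beta_i^+\,e^{d_i^+r_i}\le e$ for all $1\le i\le m$, the matrix $B$ has negative diagonal entries and $$F(\omega,\psi)-F(\omega,\phi)\ge B\,(\psi(0)-\phi(0))\quad\text{whenever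 }\phi\le_B\psi\text{ and }\omega\in\Omega,$$ whence the induced skew-product semiflow $\tau$ is monotone for $\le_B$ (i.e. if $\phi\le_B\psi$ and $\omega\in\Omega$, then $y_t(\omega,\phi)\le_By_t(\omega,\psi)$ for all $t\ge0$ for which both are defined). (ii) Whenever $r_i\,\beta_i^+\,e^{d_i^+r_i}<e$ for all $1\le i\le m$, $$F(\omega,\psi)-F(\omega,\phi)\gg B\,(\psi(0)-\phi(0))\quad\text{whenever }\phi\le_B\psi,\ \phi\ll\psi\text{ and }\omega\in\Omega,$$ and besides, for $r:=\max(r_1,\dots,r_m)$: (ii.1) if $\omega\in\Omega$ and $\phi\ge0$, then $y_t(\omega,\phi)\ge_B0$ for $t\ge r$; (ii.2) if $\omega\in\Omega$ and $\phi\ge0$ with $\phi(0)\gg0$, then $y_t(\omega,\phi)\gg_B0$ for $t\ge2r$.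
   Context: $X=C([-r_1,0])\times\cdots\times C([-r_m,0])$ with the sup-norm. For $y\in\mathbb{R}^m$, $y\ge0$ (resp. $y\gg0$) means all components are nonnegative (resp. positive). For $\phi,\psi\in X$, $\phi\le\psi$ (resp. $\phi\ll\psi$) means $\phi_i(s)\le\psi_i(s)$ (resp. $<$) for all $s\in[-r_i,0]$ and all $i$; $\phi(0)=(\phi_1(0),\dots,\phi_m(0))$. Hull: let $l:\mathbb{R}\to\mathbb{R}^N$ be the map whose components are all the coefficients, $l(t)=(\widetilde d_i(t),\widetilde a_{ij}(t),\widetilde\beta_i(t),\widetilde c_i(t))$, and let $\Omega$ be its hull, i.e. the closure of the set of time-translates of $l$ in the compact-open topology, with the shift flow $(\omega\cdot t)(s)=\omega(t+s)$, which is minimal and almost periodic on the compact metric space $\Omega$. Continuous nonnegative maps $d_i,a_{ij},\beta_i,c_i:\Omega\to\mathbb{R}$ are defined by $(d_i(\omega),a_{ij}(\omega),\beta_i(\omega),c_i(\omega))=\omega(0)$. The family of systems over the hull is, for $\omega\in\Omega$, $1\le i\le m$, $$y_i'(t)=-d_i(\omega\cdot t)y_i(t)+\sum_{j=1}^ma_{ij}(\omega\cdot t)y_j(t)+\beta_i(\omega\cdot t)y_i(t-r_i)e^{-c_i(\omega\cdot t)y_i(t-r_i)},$$ written as $y'(t)=F(\omega\cdot t,y_t)$, i.e. $F_i(\omega,\phi)=-d_i(\omega)\phi_i(0)+\sum_ja_{ij}(\omega)\phi_j(0)+\beta_i(\omega)\phi_i(-r_i)e^{-c_i(\omega)\phi_i(-r_i)}$.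 $y(t,\omega,\varphi)$ is the solution with initial value $\varphi\in X$, $y_t(\omega,\varphi)\in X$ has components $s\mapsto y_i(t+s,\omega,\varphi)$, $s\in[-r_i,0]$, and $\tau(t,\omega,\varphi)=(\omega\cdot t,y_t(\omega,\varphi))$. For the diagonal matrix $B$ with diagonal entries $-\mu_1,\dots,-\mu_m$, $K_B=\{\varphi\in X\mid\varphi\ge0,\ \varphi_i(t)e^{\mu_it}\ge\varphi_i(s)e^{\mu_is}\text{ for }-r_i\le s\le t\le0,\ 1\le i\le m\}$, and $\phi\le_B\psi$ iff $\psi-\phi\in K_B$. $X_L\subset X$ is the Banach space of maps with Lipschitz components, with the usual Lipschitz norm; $\widetilde K_B=K_B\cap X_L$, with interior in $X_L$ equal to $\operatorname{Int}\widetilde K_B=\{\phi\in X_L\mid\phi\gg0\text{ and, for some }\varepsilon>0,\ \phi_i'+\mu_i\phi_i\ge\varepsilon\text{ a.e. on }[-r_i,0]\text{ for all }i\}$; $\phi\gg_B0$ means $\phi\in\operatorname{Int}\widetilde K_B$. *)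

(* Defs.v *)
From HB Require Import structures.
From mathcomp Require Import all_boot all_order all_algebra.
From mathcomp Require Import all_classical all_reals all_analysis.
Set Implicit Arguments.
Unset Strict Implicit.
Unset Printing Implicit Defensive.
Import Order.TTheory GRing.Theory Num.Theory.
Import numFieldNormedType.Exports.
Local Open Scope classical_set_scope.
Local Open Scope ring_scope.

(* Almost periodicity in the sense of Bohr: continuity, and a relatively dense
   set of e-almost periods for every e > 0. *)
Definition almost_periodic (R : realType) (f : R -> R) : Prop :=
  continuous f /\
  forall e : R, 0 < e -> exists2 L : R, 0 < L &
    forall a : R, exists2 T : R, a <= T <= a + L &
      forall t : R, `|f (t + T) - f t| < e.

Section Hull.
Variables (R : realType) (m : nat).

(* R^N with N = m + m^2 + m + m, split as (d, a, beta, c). *)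
Definition coefs : Type :=
  ('rV[R]_m * 'M[R]_m * 'rV[R]_m * 'rV[R]_m)%type.

Definition nicholson_coefs (d : 'I_m -> R -> R) (a : 'I_m -> 'I_m -> R -> R)
    (beta c : 'I_m -> R -> R) (t : R) : coefs :=
  (\row_i d i t, \matrix_(i, j) a i j t, \row_i beta i t, \row_i c i t).

Definition shift_flow (w : R -> coefs) (t : R) : R -> coefs :=
  fun s => w (t + s).

(* The closure is taken in C(R, R^N), i.e. for the topology which the space of
   continuous maps inherits from the compact-open topology. *)
Definition coef_hull (l : R -> coefs) : set (R -> coefs) :=
  [set w | continuous w] `&`
  closure ([set shift_flow l t | t in [set: R]]
             : set {compact-open, R -> coefs}).

Definition dOf (w : R -> coefs) (i : 'I_m) : R := (w 0).1.1.1 ord0 i.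
Definition aOf (w : R -> coefs) (i j : 'I_m) : R := (w 0).1.1.2 i j.
Definition betaOf (w : R -> coefs) (i : 'I_m) : R := (w 0).1.2 ord0 i.
Definition cOf (w : R -> coefs) (i : 'I_m) : R := (w 0).2 ord0 i.

End Hull.

Definition vle (R : realType) (m : nat) (u v : 'cV[R]_m) : Prop :=
  forall i, u i ord0 <= v i ord0.
Definition vlt (R : realType) (m : nat) (u v : 'cV[R]_m) : Prop :=
  forall i, u i ord0 < v i ord0.

Section PhaseSpace.
Variables (R : realType) (m : nat) (r : 'I_m -> R).

(* An element of C([-r_1, 0]) x ... x C([-r_m, 0]) is represented by a family of
   functions on R of which only the restrictions to the [-r_i, 0] matter. *)
Definition hist : Type := 'I_m -> R -> R.

Definition inX : set hist :=
  [set phi | forall i, {within `[- r i, 0], continuous (phi i)}].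

Definition hsub (psi phi : hist) : hist := fun i s => psi i s - phi i s.

Definition hist0 : hist := fun _ _ => 0.

Definition at0 (phi : hist) : 'cV[R]_m := \col_i phi i 0.

Definition Xle (phi psi : hist) : Prop :=
  forall i s, - r i <= s <= 0 -> phi i s <= psi i s.
Definition Xlt (phi psi : hist) : Prop :=
  forall i s, - r i <= s <= 0 -> phi i s < psi i s.

Definition Bmx (mu : 'I_m -> R) : 'M[R]_m := diag_mx (\row_i - mu i).

Definition KB (mu : 'I_m -> R) : set hist :=
  [set phi | [/\ inX phi, Xle hist0 phi &
    forall i s t, - r i <= s -> s <= t -> t <= 0 ->
      phi i s * expR (mu i * s) <= phi i t * expR (mu i * t)]].

Definition leB (mu : 'I_m -> R) (phi psi : hist) : Prop :=
  KB mu (hsub psi phi).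

Definition XL : set hist :=
  [set phi | forall i, [lipschitz phi i s | s in `[- r i, 0]]].

Definition Xnorm (phi : hist) : R :=
  sup [set x | exists i s, - r i <= s <= 0 /\ x = `|phi i s|].

Definition lip_const (phi : hist) : R :=
  sup [set x | exists i s t, [/\ - r i <= s, s < t, t <= 0 &
    x = `|phi i t - phi i s| / (t - s)]].

Definition lip_norm (phi : hist) : R := Xnorm phi + lip_const phi.

(* Topological interior of (KB `&` XL) in XL for the Lipschitz norm. *)
Definition KBL_interior (mu : 'I_m -> R) : set hist :=
  [set phi | XL phi /\ exists2 e : R, 0 < e &
    forall psi, XL psi -> lip_norm (hsub psi phi) < e -> KB mu psi].

(* Explicit form of that interior; differentiability a.e. is spelled out because
   the derivative operator is total. *)
Definition IntKBL (mu : 'I_m -> R) : set hist :=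
  [set phi | [/\ XL phi, Xlt hist0 phi &
    exists2 e : R, 0 < e & forall i,
      {ae (@lebesgue_measure R), forall s : R, - r i <= s <= 0 ->
        derivable (phi i) s 1 /\
        e <= derive1 (phi i) s + mu i * phi i s}]].

(* The two sets above are equal; asking for membership in both avoids relying on
   this equality. *)
Definition ggB0 (mu : 'I_m -> R) (phi : hist) : Prop :=
  KBL_interior mu phi /\ IntKBL mu phi.

Definition nicholsonF (w : R -> coefs R m) (phi : hist) : 'cV[R]_m :=
  \col_i (- dOf w i * phi i 0 + \sum_(j < m) aOf w i j * phi j 0
          + betaOf w i * phi i (- r i) * expR (- cOf w i * phi i (- r i))).

Definition hist_seg (y : hist) (t : R) : hist := fun i s => y i (t + s).

(* y solves y'(t) = F(w.t, y_t) on [0, T] with initial value phi. The derivative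
   is relative to [0, T], hence one-sided at the end points. The maximal
   solution is defined at T exactly when there is such a y. *)
Definition is_solution (w : R -> coefs R m) (phi : hist) (T : R) (y : hist)
    : Prop :=
  [/\ forall i s, - r i <= s <= 0 -> y i s = phi i s,
      forall i, {within `[- r i, T], continuous (y i)} &
      forall i t, 0 <= t <= T ->
        h^-1 * (y i (t + h) - y i t)
          @[h --> within [set h | 0 <= t + h <= T] (0 : R)^']
          --> nicholsonF (shift_flow w t) (hist_seg y t) i ord0].

End PhaseSpace.

Definition nicholson_mu (R : realType) (m : nat) (r : 'I_m -> R)
    (beta : 'I_m -> R -> R) (i : 'I_m) : R :=
  (r i)^-1 * ln (expR 2 / (r i * sup (range (beta i)))).

(* Main.v *)
(** The map [x |-> x e^(-c x)] has slope at least [-e^(-2)], so for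
   [phi <=_B psi] the delayed term decreases [F psi - F phi] by at most
   [beta_i^+ e^(-2) e^(mu_i r_i)] times the gap at [0], and the choice of [mu_i]
   makes this constant equal to [1 / r_i]. The smallness condition says exactly
   that [d_i^+ + 1 / r_i <= mu_i]. For monotonicity put
   [W_i t = (z_i t - y_i t) e^(mu_i t)]. If every [W_j] is nondecreasing up to a
   time [a], then, as long as the delayed arguments stay before [a], the
   differences [W_j - W_j a] satisfy a cooperative linear differential inequality,
   hence are nonnegative by Kamke's comparison, and this in turn gives
   [W_i' >= (W_i - W_i a) / r_i >= 0]: so one advances by steps of length
   [min_i r_i].
   In (ii), Kamke's comparison shows that solutions starting in the nonnegative
   cone stay there, and then [y_i' >= - d_i^+ y_i] with [d_i^+ < mu_i]. Almost
   periodicity only serves to bound the coefficients; the bounds pass to the hull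
   because closed conditions do. *)
Require Import Defs.
From HB Require Import structures.
From mathcomp Require Import all_boot all_order all_algebra.
From mathcomp Require Import all_classical all_reals all_analysis.
From mathcomp Require Import ring lra.
Import Order.TTheory GRing.Theory Num.Theory.
Import numFieldNormedType.Exports.
Local Open Scope classical_set_scope.
Local Open Scope ring_scope.

Set Implicit Arguments.
Unset Strict Implicit.
Unset Printing Implicit Defensive.

(** * One-variable calculus and comparison arguments *)

Lemma is_derive_mul_expR (R : realType) (f : R -> R) (k t l : R) :
  is_derive t 1 f l ->
  is_derive t 1 (fun s => f s * expR (k * s)) ((l + k * f t) * expR (k * t)).
Proof.
move=> df.
have dk : is_derive t 1 (fun s : R => k * s) k.
  have := @is_deriveZ _ _ _ id k t 1 1 (is_derive_id _ _).
  by rewrite /GRing.scale/= mulr1.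
have de : is_derive t 1 (fun s => expR (k * s)) (k * expR (k * t)).
  by have := @is_derive1_comp _ expR _ t _ _ (is_derive_expR _) dk; rewrite mulrC.
have := is_deriveM df de; rewrite /GRing.scale/= => dfe.
by apply: (is_derive_eq dfe) => /=; ring.
Qed.

Lemma continuous_mul_expR (R : realType) (A : set R) (f : R -> R) (k : R) :
  {within A, continuous f} ->
  {within A, continuous (fun s => f s * expR (k * s))}.
Proof.
move=> cf x; apply: cvgM; first exact: cf.
have : continuous (fun s : R => expR (k * s)).
  move=> y; apply: continuous_comp; last exact: continuous_expR.
  by apply: cvgM; [exact: cvg_cst|exact: cvg_id].
by move=> /continuous_subspaceT; exact.
Qed.

(** A positive derivative would make [f] smaller just before [t]. Only times before [t] are
    compared, so the minimum may sit at the right end of an interval. *)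
Lemma is_derive_left_min_le0 (R : realType) (f : R -> R) (a t l : R) :
  is_derive t 1 f l -> a < t -> (forall s, a <= s <= t -> f t <= f s) -> l <= 0.
Proof.
move=> [df <-] a_t fmin; rewrite leNgt; apply/negP => l0.
have : (fun h : R => h^-1 *: ((f \o shift t) (h *: 1) - f t)) @ 0^' --> 'D_1 f t.
  exact: df.
move=> /cvgr_gt/(_ _ l0).
rewrite /prop_near1 => -[e /= e0 /(_ _ _ _) H].
(* A negative increment, short enough for the quotient to be positive and for [t + h] to stay in
   [[a, t]]. *)
pose h : R := - (Num.min (e / 2) (t - a)).
have hpos : 0 < - h by rewrite opprK lt_min divr_gt0//= subr_gt0.
have he : - h <= e / 2 by rewrite opprK ge_min lexx.
have ha : - h <= t - a by rewrite opprK ge_min lexx orbT.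
have h0 : h < 0 by lra.
have e2 : e / 2 < e by rewrite ltr_pdivrMr// ltr_pMr// ltr1n.
have := H h; rewrite /= sub0r normrN ltr0_norm// => /(_ (le_lt_trans he e2)).
rewrite lt_eqF// => /(_ isT).
rewrite /GRing.scale/= mulr1.
have : f t <= f (h + t) by apply: fmin; lra.
move=> ft; rewrite ltNge => /negP; apply.
by apply: mulr_le0_ge0; [rewrite invr_le0 ltW|rewrite subr_ge0].
Qed.

(** The derivative is required only inside the interval, since a solution has just a one-sided one
    at the ends; continuity up to the ends suffices for the mean value theorem. *)
Lemma slope_ge (R : realType) (f df : R -> R) (a b k : R) : a <= b ->
  {within `[a, b], continuous f} ->
  (forall x, a < x < b -> is_derive x 1 f (df x)) ->
  (forall x, a < x < b -> k <= df x) ->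
  k * (b - a) <= f b - f a.
Proof.
rewrite le_eqVlt => /predU1P[->|ab] cf fdf kdf; first by rewrite !subrr mulr0.
have {}fdf x : x \in `]a, b[ -> is_derive x 1 f (df x).
  by rewrite in_itv; exact: fdf.
have [x xab ->] := MVT ab fdf cf.
rewrite ler_wpM2r ?subr_ge0 ?(ltW ab)//; apply: kdf.
by move: xab; rewrite in_itv.
Qed.

Lemma slope_le (R : realType) (f df : R -> R) (a b k : R) : a <= b ->
  {within `[a, b], continuous f} ->
  (forall x, a < x < b -> is_derive x 1 f (df x)) ->
  (forall x, a < x < b -> df x <= k) ->
  f b - f a <= k * (b - a).
Proof.
rewrite le_eqVlt => /predU1P[->|ab] cf fdf kdf; first by rewrite !subrr mulr0.
have {}fdf x : x \in `]a, b[ -> is_derive x 1 f (df x).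
  by rewrite in_itv; exact: fdf.
have [x xab ->] := MVT ab fdf cf.
rewrite ler_wpM2r ?subr_ge0 ?(ltW ab)//; apply: kdf.
by move: xab; rewrite in_itv.
Qed.

Lemma within_ge0_end (R : realType) (f : R -> R) (a b : R) : a < b ->
  {within `[a, b], continuous f} -> (forall t, a < t < b -> 0 <= f t) ->
  0 <= f b.
Proof.
move=> ab cf f0; have [_ _ fb] := (continuous_within_itvP _ ab).1 cf.
rewrite -(cvg_lim _ fb)//.
apply: limr_ge; first by apply/cvg_ex; exists (f b).
near=> x; apply: f0; apply/andP; split; near: x.
  exact: nbhs_left_gt.
exact: nbhs_left_lt.
Unshelve. all: by end_near. Qed.

(* Kamke's comparison principle. The minimum over [i] and [t] of
   [V i t * expR (- K * t)], with [K > M], cannot be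
   negative: there the derivative would be positive. *)
Lemma kamke_ge0 (R : realType) (m : nat) (V dV : 'I_m -> R -> R)
    (q : 'I_m -> R -> R) (P : 'I_m -> 'I_m -> R -> R) (M a b : R) :
  (forall i, {within `[a, b], continuous (V i)}) ->
  (forall i t, a < t < b -> is_derive t 1 (V i) (dV i t)) ->
  (forall i j t, a < t < b -> 0 <= P i j t) ->
  (forall i t, a < t < b -> q i t + \sum_j P i j t <= M) ->
  (forall i t, a < t < b ->
    q i t * V i t + \sum_j P i j t * V j t <= dV i t) ->
  (forall i, 0 <= V i a) ->
  forall i t, a <= t <= b -> 0 <= V i t.
Proof.
move=> cV dVV P0 PM PV Va.
(* Stopping at [T < b] ensures that a minimum attained at [T] still has a derivative; [b] itself is
   reached by continuity. *)
have main i T : a < T < b -> 0 <= V i T.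
  move=> /andP[aT Tb].
  pose U i s := V i s * expR (- (M + 1) * s).
  have cU j : {within `[a, T], continuous (U j)}.
    apply: continuous_mul_expR; apply: (continuous_subspaceW _ (cV j)).
    by apply: subset_itvl; rewrite bnd_simp ltW.
  have minU j : {x | x \in `[a, T] & forall t, t \in `[a, T] -> U j x <= U j t}.
    by apply: cid2; exact: (EVT_min (ltW aT) (cU j)).
  pose x j := s2val (minU j).
  have [j _ jmin] := @Order.TotalTheory.arg_minP _ _ _ i xpredT (fun j => U j (x j)) isT.
  have xj : x j \in `[a, T] by exact: (s2valP (minU j)).
  have Umin k s : a <= s <= T -> U j (x j) <= U k s.
    move=> sT; apply: (le_trans (jmin k isT)).
    by apply: (s2valP' (minU k)); rewrite in_itv.
  suff Uj : 0 <= U j (x j).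
    have := le_trans Uj (Umin i T _); rewrite lexx ltW// => /(_ isT).
    by rewrite /U pmulr_lge0// expR_gt0.
  rewrite leNgt; apply/negP => Uj.
  move: xj; rewrite in_itv/= le_eqVlt => /andP[/predU1P[ax|ax] xT].
    move: Uj; rewrite /U -ax ltNge => /negP; apply.
    by rewrite mulr_ge0 ?expR_ge0.
  have axb : a < x j < b by rewrite ax (le_lt_trans xT).
  have := is_derive_mul_expR (- (M + 1)) (dVV j _ axb).
  move=> /is_derive_left_min_le0 /(_ ax) H.
  have {}H : (dV j (x j) + - (M + 1) * V j (x j)) * expR (- (M + 1) * x j) <= 0.
    by apply: H => s /andP[xas xs]; apply: Umin; rewrite xas (le_trans xs).
  move: H; rewrite pmulr_lle0 ?expR_gt0// => H.
  have Vj : V j (x j) < 0 by move: Uj; rewrite /U pmulr_llt0 ?expR_gt0.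
  (* At the common time [x j] the weights cancel. Then [dV j >= (q j + \sum_k P j k) * V j >= M * V
     j > (M + 1) * V j], because [V j < 0]; this contradicts [H]. *)
  have Vk k : V j (x j) <= V k (x j).
    have := Umin k (x j); rewrite (ltW ax) xT => /(_ isT).
    by rewrite /U ler_pM2r ?expR_gt0.
  have : (\sum_k P j k (x j)) * V j (x j) <= \sum_k P j k (x j) * V k (x j).
    rewrite mulr_suml; apply: ler_sum => k _.
    by rewrite ler_wpM2l ?P0.
  have := PV j _ axb.
  have : M * V j (x j) <= (q j (x j) + \sum_k P j k (x j)) * V j (x j).
    by rewrite ler_wnM2r ?PM// ltW.
  move: H; set S := \sum_k _ * _; set p := (\sum_k _).
  by move=> H1 H2 H3 H4; nra.
move=> i t /andP[]; rewrite le_eqVlt => /predU1P[<- _|a_t]; first exact: Va.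
rewrite le_eqVlt => /predU1P[tb|tb]; last by apply: main; rewrite a_t.
rewrite tb; apply: (within_ge0_end (a := a)); rewrite -?tb//.
  by rewrite tb; exact: cV.
by rewrite tb; exact: main.
Qed.

(** Method of steps: the times [min (n * rho) t] reach [t] after finitely many advances. With [rho]
    below every delay, delayed arguments fall where the property is already known. *)
Lemma step_ind (R : realType) (P : R -> Prop) (rho T : R) : 0 < rho ->
  P 0 -> (forall a b, 0 <= a -> a <= b -> b <= a + rho -> b <= T -> P a -> P b) ->
  forall t, 0 <= t <= T -> P t.
Proof.
move=> rho0 P0 step t /andP[t0 tT].
have main n : P (Num.min (n%:R * rho) t).
  elim: n => [|n IH]; first by rewrite mul0r min_l.
  apply: (step _ _ _ _ _ _ IH).
  - by rewrite le_min t0 mulr_ge0// ltW.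
  - by rewrite le_min !ge_min lexx orbT andbT ler_wpM2r ?ler_nat// ltW.
  - rewrite -addn1 natrD mulrDl mul1r minElt [X in _ <= X + _]minElt.
    by case: ifP; case: ifP; lra.
  - by rewrite ge_min tT orbT.
have := main (Num.truncn (t / rho)).+1; rewrite min_r//.
by rewrite -ler_pdivrMr// ltW// truncnS_gt.
Qed.

(** * Global existence by successive approximation *)

Lemma primitive_exists (R : realType) (f : R -> R) : continuous f ->
  exists2 F : R -> R, F 0 = 0 & forall t : R, 0 <= t -> is_derive t 1 F (f t).
Proof.
(* Integrating from [-1] makes [0] an interior point, so that the derivative is two-sided there. *)
move=> cf; pose F x := (\int[lebesgue_measure]_(s in `[-1, x]) f s)%R.
exists (fun x => F x - F 0); first by rewrite subrr.
move=> t t0; have fi : lebesgue_measure.-integrable `[-1, t + 1] (EFin \o f).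
  apply: continuous_compact_integrable; first exact: segment_compact.
  exact: continuous_subspaceT.
have t1 : t < t + 1 by rewrite ltrDl.
have a1 : -1 < t by rewrite (lt_le_trans _ t0)// ltrN10.
have [dF FE] := continuous_FTC1_closed t1 fi a1 (cf t).
have dF' : is_derive t 1 F (f t) by apply: DeriveDef => //; rewrite -derive1E.
by have := is_deriveB dF' (is_derive_cst (F 0) t 1); rewrite subr0.
Qed.

(** With [e n = 2 * A * 2^-1 ^+ n], the intervals [[u n - e n, u n + e n]] are nested; the supremum
    of their left ends lies in all of them. *)
Lemma geometric_cauchy (R : realType) (u : nat -> R) (A : R) :
  (forall n, `|u n.+1 - u n| <= A * 2^-1 ^+ n) ->
  exists l, forall n, `|l - u n| <= 2 * A * 2^-1 ^+ n.
Proof.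
move=> hu; pose e n : R := 2 * A * 2^-1 ^+ n.
have eS n : e n = e n.+1 + A * 2^-1 ^+ n by rewrite /e exprS; field.
have e0 n : 0 <= e n.
  by rewrite /e -mulrA mulr_ge0// (le_trans _ (hu n)).
have low n k : u n - e n <= u (n + k)%N - e (n + k)%N.
  elim: k => [|k IH]; first by rewrite addn0.
  rewrite addnS (le_trans IH)//.
  by have := hu (n + k)%N; rewrite ler_norml => /andP[+ _]; rewrite (eS (n + k)%N); lra.
have upp n k : u (n + k)%N + e (n + k)%N <= u n + e n.
  elim: k => [|k IH]; first by rewrite addn0.
  rewrite addnS (le_trans _ IH)//.
  by have := hu (n + k)%N; rewrite ler_norml => /andP[_ +]; rewrite (eS (n + k)%N); lra.
pose S := range (fun n => u n - e n).
have ubS n : ubound S (u n + e n).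
  move=> _ [k _ <-]; have := low k n; have := upp n k; rewrite addnC.
  by have := e0 (k + n)%N; lra.
exists (sup S) => n.
have S0 : S !=set0 by exists (u 0%N - e 0%N), 0%N.
have h1 : sup S <= u n + e n by exact: ge_sup.
have h2 : u n - e n <= sup S.
  by apply: ub_le_sup; [exists (u n + e n)|exists n].
by rewrite -/(e n) ler_norml; lra.
Qed.

Lemma continuous_max0 (R : realType) : continuous (fun t : R => Num.max t 0).
Proof.
move=> t; have i : {for t, continuous (fun s : R => s : R^o)} by exact: cvg_id.
have c : {for t, continuous (fun=> 0 : R^o)} by exact: cvg_cst.
exact: continuous_max i c.
Qed.

Lemma continuous_min0 (R : realType) : continuous (fun t : R => Num.min t 0).
Proof.
move=> t; have i : {for t, continuous (fun s : R => s : R^o)} by exact: cvg_id.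
have c : {for t, continuous (fun=> 0 : R^o)} by exact: cvg_cst.
exact: continuous_min i c.
Qed.

Lemma continuous_comp_max0 (R : realType) (F f : R -> R) :
  (forall t : R, 0 <= t -> is_derive t 1 F (f t)) ->
  continuous (fun t : R => F (Num.max t 0)).
Proof.
move=> dF t.
have cF : {for Num.max t 0, continuous F}.
  apply: differentiable_continuous; apply/derivable1_diffP.
  by have [] := dF (Num.max t 0) _; rewrite // le_max lexx orbT.
exact: (continuous_comp (@continuous_max0 R t) cF).
Qed.

(* Picard iteration. Measuring differences against [expR (2 * K * t)] makes the
   iteration a contraction by 1/2 on the whole half line. *)
Section Picard.
Variables (R : realType) (m : nat).
Variable G : 'I_m -> ('I_m -> R -> R) -> R -> R.
Variables (phi : 'I_m -> R -> R) (K M : R).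
Hypothesis K1 : 1 <= K.
Hypothesis phi_cont : forall i, continuous (phi i).
Hypothesis G_cont : forall y : 'I_m -> R -> R, (forall i, continuous (y i)) ->
  forall i, continuous (G i y).
Hypothesis G_lip : forall (y z : 'I_m -> R -> R) (t e : R), 0 <= t ->
  (forall j s, s <= t -> `|y j s - z j s| <= e) ->
  forall i, `|G i y t - G i z t| <= K * e.
Hypothesis G_phi : forall i (t : R), 0 <= t -> `|G i phi t| <= M.
Hypothesis phi_cst : forall i (t : R), 0 <= t -> phi i t = phi i 0.

(** The truncations write the integrated equation on the whole line: the [F] term vanishes before
    [0], the history is frozen at [phi i 0] after it, and the result is continuous across [0]. *)
Let step_spec (y z : 'I_m -> R -> R) :=
  forall i, exists F, [/\ F 0 = 0, forall t : R, 0 <= t -> is_derive t 1 F (G i y t)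
    & forall t, z i t = phi i (Num.min t 0) + F (Num.max t 0)].

Let step_ex y : (forall i, continuous (y i)) -> exists z, step_spec y z.
Proof.
move=> cy.
have /choice [F HF] : forall i, exists F : R -> R,
    F 0 = 0 /\ forall t : R, 0 <= t -> is_derive t 1 F (G i y t).
  by move=> i; have [F F0 dF] := primitive_exists (@G_cont y cy i); exists F.
exists (fun i t => phi i (Num.min t 0) + F i (Num.max t 0)) => i.
by exists (F i); have [? ?] := HF i; split.
Qed.

Let step_cont y z : step_spec y z -> forall i, continuous (z i).
Proof.
move=> yz i t; have [F [F0 dF zE]] := yz i.
have -> : z i = fun t => phi i (Num.min t 0) + F (Num.max t 0) by apply/funext.
apply: cvgD; first exact: (continuous_comp (@continuous_min0 R t) (@phi_cont i _)).
exact: (@continuous_comp_max0 _ _ _ dF).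
Qed.

Let step_le0 y z : step_spec y z -> forall i t, t <= 0 -> z i t = phi i t.
Proof.
move=> yz i t t0; have [F [F0 dF ->]] := yz i.
by rewrite min_l// max_r// F0 addr0.
Qed.

Let K0 : 0 <= K. Proof. exact: le_trans ler01 K1. Qed.

Let E (t : R) : R := expR (2 * K * t).

Let dE (C t : R) : is_derive t 1 (fun s => C * E s) (2 * K * C * E t).
Proof.
have H := is_derive_mul_expR (2 * K) (is_derive_cst C t (1 : R)).
by apply: (is_derive_eq H); rewrite /E /cst; ring.
Qed.

Let E_ge1 t : 0 <= t -> 1 <= E t.
Proof. by move=> t0; rewrite /E -expR0 ler_expR !mulr_ge0. Qed.

Let E_le s t : s <= t -> E s <= E t.
Proof. by move=> st; rewrite /E ler_expR ler_wpM2l// mulr_ge0. Qed.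

(** [C * E] has derivative [2 * K * C * E], so [C * E + F] and [C * E - F] are nondecreasing, and
    they are nonnegative at [0]. *)
Let derive_bound (F f : R -> R) (C : R) : 0 <= C -> F 0 = 0 ->
  (forall t : R, 0 <= t -> is_derive t 1 F (f t)) ->
  (forall t, 0 <= t -> `|f t| <= 2 * K * C * E t) ->
  forall t, 0 <= t -> `|F t| <= C * E t.
Proof.
move=> C0 F0 dF fE t t0.
have cnt (H h : R -> R) : (forall t : R, 0 <= t -> is_derive t 1 H (h t)) ->
    {within `[0, t], continuous H}.
  move=> dH; apply: derivable_within_continuous => x.
  by rewrite in_itv/= => /andP[x0 _]; have [] := dH _ x0.
rewrite ler_norml; apply/andP; split.
  have d1 (x : R) : 0 <= x ->
      is_derive x 1 (fun s => F s + C * E s) (f x + 2 * K * C * E x).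
    by move=> x0; exact: is_deriveD (dF _ x0) (dE C x).
  have := slope_ge (k := 0) t0 (cnt _ _ d1) (fun x h => d1 x (ltW (andP h).1)).
  have dge x : 0 < x < t -> 0 <= f x + 2 * K * C * E x.
    by move=> /andP[/ltW/fE + _]; rewrite ler_norml; lra.
  rewrite mul0r => /(_ dge).
  by rewrite F0; have := E_ge1 (lexx 0); nra.
have d1 (x : R) : 0 <= x ->
    is_derive x 1 (fun s => C * E s - F s) (2 * K * C * E x - f x).
  by move=> x0; exact: is_deriveB (dE C x) (dF _ x0).
have := slope_ge (k := 0) t0 (cnt _ _ d1) (fun x h => d1 x (ltW (andP h).1)).
have dge x : 0 < x < t -> 0 <= 2 * K * C * E x - f x.
  by move=> /andP[/ltW/fE + _]; rewrite ler_norml; lra.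
rewrite mul0r => /(_ dge).
by rewrite F0; have := E_ge1 (lexx 0); nra.
Qed.

(** The factor 1/2: the integrands differ by at most [K * (C * E x) = 2 * K * (C / 2) * E x].
    Earlier arguments are covered because [E] is nondecreasing and the histories agree. *)
Let step_contract y y' z z' C : 0 <= C ->
  (forall i, continuous (y i)) -> (forall i, continuous (y' i)) ->
  step_spec y z -> step_spec y' z' ->
  (forall j s, s <= 0 -> y j s = y' j s) ->
  (forall j s, 0 <= s -> `|y j s - y' j s| <= C * E s) ->
  forall i t, 0 <= t -> `|z i t - z' i t| <= C / 2 * E t.
Proof.
move=> C0 cy cy' yz yz' y0 yE i t t0.
have [F [F0 dF ->]] := yz i; have [F' [F0' dF' ->]] := yz' i.
rewrite opprD addrACA subrr add0r max_l//.
have d1 (x : R) : 0 <= x -> is_derive x 1 (fun s => F s - F' s) (G i y x - G i y' x).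
  by move=> x0; exact: is_deriveB (dF _ x0) (dF' _ x0).
apply: (derive_bound _ _ d1) => //; first by rewrite divr_ge0.
  by rewrite F0 F0' subrr.
move=> x x0; have -> : 2 * K * (C / 2) * E x = K * (C * E x) by field.
apply: G_lip => // j s sx; case: (lerP 0 s) => s0.
  by rewrite (le_trans (yE _ _ s0))// ler_wpM2l// E_le.
rewrite y0; last exact: ltW.
by rewrite subrr normr0 mulr_ge0// expR_ge0.
Qed.

Lemma picard : exists y : 'I_m -> R -> R, [/\ forall i, continuous (y i),
  forall i t, t <= 0 -> y i t = phi i t &
  forall i, exists2 p : R -> R, forall t : R, 0 <= t -> y i t = p t &
    forall t : R, 0 <= t -> is_derive t 1 p (G i y t)].
Proof.
have M0 : 0 <= `|M| by [].
(* Iterates carry their continuity, which the next step requires to have a primitive. *)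
pose cont := {y : 'I_m -> R -> R | forall i, continuous (y i)}.
have /choice[next nextP] : forall y : cont, exists z : cont, step_spec (sval y) (sval z).
  move=> [y cy]; have [z yz] := step_ex cy.
  by exists (exist _ z (step_cont yz)).
pose y0 : cont := exist _ phi phi_cont.
pose u n := sval (iter n next y0).
have uS n : step_spec (u n) (u n.+1) by exact: nextP.
have cu n i : continuous (u n i) by exact: (svalP (iter n next y0)).
have u0 n i (t : R) : t <= 0 -> u n i t = phi i t.
  by case: n => [//|n]; exact: step_le0.
have du n i (t : R) : 0 <= t -> `|u n.+1 i t - u n i t| <= `|M| * E t * 2^-1 ^+ n.
  elim: n i t => [|n IH] i t t0.
    have [F [F0 dF ->]] := uS 0%N i.
    rewrite expr0 mulr1 min_r// max_l// /u/= (phi_cst _ t0) addrC addKr.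
    apply: (derive_bound _ F0 dF) => // x x0.
    rewrite (le_trans (G_phi _ x0))// (le_trans (ler_norm _))//.
    have -> : 2 * K * `|M| * E x = 2 * K * E x * `|M| by ring.
    by rewrite ler_peMl//; have := E_ge1 x0; have := K1; nra.
  have -> : `|M| * E t * 2^-1 ^+ n.+1 = `|M| * 2^-1 ^+ n / 2 * E t.
    by rewrite exprS; field.
  have C0 : 0 <= `|M| * 2^-1 ^+ n by rewrite mulr_ge0// exprn_ge0.
  apply: (step_contract C0 (cu n.+1) (cu n) (uS n.+1) (uS n)) => //.
  - by move=> j s s0; rewrite !u0.
  - by move=> j s s0; rewrite mulrAC; exact: IH.
have /choice[y yP] : forall i, exists y : R -> R, forall t : R, 0 <= t ->
    forall n, `|y t - u n i t| <= 2 * (`|M| * E t) * 2^-1 ^+ n.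
  move=> i; have /choice[y yP] : forall t : R, exists l, 0 <= t ->
      forall n, `|l - u n i t| <= 2 * (`|M| * E t) * 2^-1 ^+ n.
    move=> t; case: (leP 0 t) => [t0|_]; last by exists 0.
    by have [l lP] := geometric_cauchy (fun n => du n i t t0); exists l.
  by exists y.
(* The limit [y i] is controlled only for [t >= 0]; the history is glued on before. *)
pose z i (t : R) := if 0 <= t then y i t else phi i t.
have zu n i (t : R) : 0 <= t -> `|z i t - u n i t| <= 2 * `|M| * 2^-1 ^+ n * E t.
  move=> t0; rewrite /z t0; have := yP i t t0 n.
  by rewrite mulrA mulrAC.
have small (A e : R) : 0 <= A -> 0 < e -> exists n, A * 2^-1 ^+ n < e.
  move=> A0 e0; have : A * 2^-1 ^+ n @[n --> \oo] --> A * 0.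
    by apply: cvgMr; apply: cvg_expr; rewrite ger0_norm// invf_lt1// ltr1n.
  rewrite mulr0 => /cvgr_lt/(_ _ e0) [n _ /(_ n (leqnn n))]; by exists n.
have z0 i (t : R) : t <= 0 -> z i t = phi i t.
  rewrite /z le_eqVlt => /predU1P[->|t0]; last by rewrite leNgt t0.
  rewrite lexx; apply/eqP; rewrite -subr_eq0 -normr_le0; apply/ler_addgt0Pl => e e0.
  have E0 : 0 <= E 0 by exact: expR_ge0.
  rewrite addr0.
  have [n ne] := small _ _ (mulr_ge0 (ler0n R 2) (mulr_ge0 M0 E0)) e0.
  by have := yP i 0 (lexx 0) n; rewrite u0// => /le_trans; apply; exact: ltW.
(* Three-epsilon argument: convergence is uniform for times up to [|t| + 1], where [E] is
   bounded. *)
have cz i : continuous (z i).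
  move=> t; apply/cvgrPdist_lt => e e0.
  have E1 : 0 < E (`|t| + 1) by exact: expR_gt0.
  have e3 : 0 < e / 3 by rewrite divr_gt0.
  have [n ne] := small _ _ (mulr_ge0 (mulr_ge0 (ler0n R 2) M0) (ltW E1)) e3.
  have near_bound s : s <= `|t| + 1 -> `|z i s - u n i s| < e / 3.
    move=> s1; case: (leP 0 s) => s0; last first.
      by rewrite z0 ?(ltW s0)// u0 ?(ltW s0)// subrr normr0 divr_gt0.
    apply: le_lt_trans (zu n i s s0) (le_lt_trans _ ne).
    by rewrite mulrAC ler_wpM2r ?exprn_ge0// ler_wpM2l ?mulr_ge0// E_le.
  have tt : t <= `|t| + 1 by rewrite (le_trans (ler_norm t))// lerDl.
  have := near_bound t tt.
  have /cvgrPdist_lt/(_ _ e3) := @cu n i t.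
  move=> cun ht; near=> s.
  have h1 : `|z i s - u n i s| < e / 3.
    apply: near_bound; near: s.
    exists 1 => //= s ts; have {ts} : `|t - s| < 1 by [].
    by rewrite ltr_norml => /andP[+ _]; have := ler_norm t; lra.
  have h2 : `|u n i t - u n i s| < e / 3 by near: s.
  by have := ht; move: h1 h2; rewrite !ltr_norml; lra.
(* The limit is a fixed point: by contraction the iterates also converge to its image [z']. *)
have [z' zz'] := step_ex cz.
have zE i (t : R) : 0 <= t -> z i t = z' i t.
  move=> t0; apply/eqP; rewrite -subr_eq0 -normr_le0; apply/ler_addgt0Pl => e e0.
  have E0 : 0 <= E t by exact: expR_ge0.
  rewrite addr0.
  have [n ne] := small _ _ (mulr_ge0 (ler0n R 2) (mulr_ge0 M0 E0)) e0.
  have h1 := zu n.+1 i t t0.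
  have h2 : `|z' i t - u n.+1 i t| <= 2 * `|M| * 2^-1 ^+ n / 2 * E t.
    have C0 : 0 <= 2 * `|M| * 2^-1 ^+ n by rewrite !mulr_ge0// exprn_ge0.
    apply: (step_contract C0 cz (cu n) zz' (uS n)) => //.
    - by move=> j s s0; rewrite z0 ?u0.
    - by move=> j s s0; exact: zu.
  have : `|z i t - z' i t| <= 2 * (`|M| * E t) * 2^-1 ^+ n.
    have -> : 2 * (`|M| * E t) * 2^-1 ^+ n = 2 * `|M| * 2^-1 ^+ n.+1 * E t
        + 2 * `|M| * 2^-1 ^+ n / 2 * E t.
      by rewrite exprS; field.
    have -> : z i t - z' i t = (z i t - u n.+1 i t) - (z' i t - u n.+1 i t) by ring.
    by rewrite (le_trans (ler_normB _ _))// lerD.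
  by move=> /le_trans; apply; exact: ltW.
exists z; split => // i.
have [F [F0 dF Fz]] := zz' i.
exists (fun t => phi i 0 + F t) => [t t0|t t0].
  by rewrite zE// Fz min_r// max_l.
have := is_deriveD (is_derive_cst (phi i 0) t 1) (dF t t0).
by rewrite add0r.
Unshelve. all: by end_near. Qed.

End Picard.

(** * The nonlinearity [x * expR (- c * x)] *)

Lemma ricker_slope_ge (R : realType) (c x y : R) : 0 <= c -> x <= y ->
  - expR (- 2) * (y - x) <= y * expR (- c * y) - x * expR (- c * x).
Proof.
move=> c0 xy.
have df (t : R) : is_derive t 1 (fun s => s * expR (- c * s))
    ((1 + - c * t) * expR (- c * t)).
  exact: is_derive_mul_expR (is_derive_id t 1).
apply: (slope_ge (df := fun t => (1 + - c * t) * expR (- c * t))) => //.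
  by apply: derivable_within_continuous => t _; have [] := df t.
(* With [u = c * t - 2] one has [1 - c * t = - (1 + u)], so after factoring out [expR (- 2)] the
   bound is [1 + u <= expR u]. *)
move=> t _; have -> : expR (- c * t) = expR (- 2) / expR (c * t - 2).
  by rewrite -expRN -expRD; congr expR; ring.
have E0 := expR_gt0 (c * t - 2); have E1 := expR_ge1Dx (c * t - 2).
have : - 1 <= (1 + - c * t) / expR (c * t - 2) by rewrite ler_pdivlMr//; lra.
rewrite mulrCA; have := expR_gt0 (- 2 : R); nra.
Qed.

Lemma ricker_slope_le (R : realType) (c x y : R) : 0 <= c -> 0 <= x -> x <= y ->
  y * expR (- c * y) - x * expR (- c * x) <= y - x.
Proof.
move=> c0 x0 xy.
have e1 : expR (- c * x) <= 1 by rewrite -expR0 ler_expR mulNr oppr_le0 mulr_ge0.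
have e2 : expR (- c * y) <= expR (- c * x) by rewrite ler_expR !mulNr lerN2 ler_wpM2l.
have := expR_gt0 (- c * x).
have : y * expR (- c * y) <= y * expR (- c * x) by rewrite ler_wpM2l// (le_trans x0).
by nra.
Qed.

(** For [c > 0] the slope is unbounded on negative arguments, while on nonnegative ones the constant
    1 works for every [c]. This is what truncating the delayed argument at [0] exploits. *)
Lemma ricker_lip (R : realType) (c x y : R) : 0 <= c -> 0 <= x -> 0 <= y ->
  `|x * expR (- c * x) - y * expR (- c * y)| <= `|x - y|.
Proof.
move=> c0.
have main u v : 0 <= u -> u <= v ->
    `|v * expR (- c * v) - u * expR (- c * u)| <= `|v - u|.
  move=> u0 uv; rewrite [leRHS]ger0_norm ?subr_ge0// ler_norml.
  rewrite ricker_slope_le// andbT (le_trans _ (ricker_slope_ge c0 uv))//.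
  have : expR (- 2) <= 1 :> R by rewrite -expR0 ler_expR oppr_le0.
  have : 0 <= v - u by rewrite subr_ge0.
  by nra.
move=> x0 y0; have [xy|/ltW yx] := leP x y; last exact: main.
by rewrite distrC [leRHS]distrC main.
Qed.

Lemma dist_max0 (R : realType) (x y : R) :
  `|Num.max x 0 - Num.max y 0| <= `|x - y|.
Proof.
have [x0|x0] := leP 0 x; have [y0|y0] := leP 0 y => //.
- rewrite subr0 !ger0_norm ?subr_ge0; lra.
- rewrite sub0r normrN [leRHS]distrC !ger0_norm ?subr_ge0; lra.
- by rewrite subrr normr0.
Qed.

(** * Bounds on the coefficients and their passage to the hull *)

Lemma almost_periodic_bounded (R : realType) (f : R -> R) :
  almost_periodic f -> exists M, forall t, `|f t| <= M.
Proof.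
move=> [cf /(_ 1 ltr01)[L L0 per]].
have cnf : continuous (fun t => `|f t|).
  move=> t; have cn : {for f t, continuous (fun x : R => `|x|)} by exact: norm_continuous.
  exact: (continuous_comp (cf t) cn).
have [x _ xmax] := EVT_max (ltW L0) (continuous_subspaceT (A := `[0, L]) cnf).
(* A 1-almost period moves [t] into [[0, L]], changing the value by less than 1. *)
exists (`|f x| + 1) => t; have [T /andP[aT Ta] /(_ t) fT] := per (- t).
have : `|f (t + T)| <= `|f x| by apply: xmax; rewrite in_itv/=; lra.
have := ler_distD (f (t + T)) (f t) 0; rewrite !subr0 [X in _ <= X + _]distrC; lra.
Qed.

Lemma almost_periodic_le_sup (R : realType) (f : R -> R) t :
  almost_periodic f -> f t <= sup (range f).
Proof.
move=> /almost_periodic_bounded[M fM]; apply: ub_le_sup; last by exists t.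
by exists M => _ [s _ <-]; rewrite (le_trans (ler_norm _)).
Qed.

(** Since [{s}] is compact, the maps sending [s] outside the closed set [F] are open in the
    compact-open topology; if [w] were one of them, so would be some translate of [l]. *)
Lemma coef_hull_closed (R : realType) (m : nat) (l w : R -> coefs R m)
    (F : set (coefs R m)) : closed F -> (forall t, F (l t)) ->
  coef_hull l w -> forall s, F (w s).
Proof.
move=> clF lF [_ wl] s; apply: contrapT => nFw.
have oF : open (~` F) by exact: closed_openC.
pose O := [set g : R -> coefs R m | g @` [set s] `<=` ~` F].
have oO : open (O : set {compact-open, R -> coefs R m}).
  exact: compact_open_open (@compact_set1 _ s) oF.
have wO : O w by move=> _ [_ -> <-].
have [_ [[t _ <-] gO]] := wl O (open_nbhs_nbhs (conj oO wO)).
by apply: (gO (l (t + s))); [exists s|exact: lF].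
Qed.

Lemma continuous_at_fst (U V : topologicalType) (p : U * V) :
  {for p, continuous fst}.
Proof. exact: cvg_fst. Qed.

Lemma continuous_at_snd (U V : topologicalType) (p : U * V) :
  {for p, continuous snd}.
Proof. exact: cvg_snd. Qed.

Section HullCoefs.
Variables (R : realType) (m : nat).
Implicit Types x : coefs R m.

Lemma continuous_coef_d i : continuous (fun x => x.1.1.1 ord0 i).
Proof.
move=> x; have c1 := @continuous_at_fst _ _ x; have c2 := @continuous_at_fst _ _ x.1.
have c3 := @continuous_at_fst _ _ x.1.1.
exact: (continuous_comp (continuous_comp c1 (continuous_comp c2 c3))
  (@coord_continuous _ _ _ ord0 i x.1.1.1)).
Qed.

Lemma continuous_coef_a i j : continuous (fun x => x.1.1.2 i j).
Proof.
move=> x; have c1 := @continuous_at_fst _ _ x; have c2 := @continuous_at_fst _ _ x.1.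
have c3 := @continuous_at_snd _ _ x.1.1.
exact: (continuous_comp (continuous_comp c1 (continuous_comp c2 c3))
  (@coord_continuous _ _ _ i j x.1.1.2)).
Qed.

Lemma continuous_coef_beta i : continuous (fun x => x.1.2 ord0 i).
Proof.
move=> x; have c1 := @continuous_at_fst _ _ x; have c2 := @continuous_at_snd _ _ x.1.
exact: (continuous_comp (continuous_comp c1 c2)
  (@coord_continuous _ _ _ ord0 i x.1.2)).
Qed.

Lemma continuous_coef_c i : continuous (fun x => x.2 ord0 i).
Proof.
move=> x; exact: (continuous_comp (@continuous_at_snd _ _ x)
  (@coord_continuous _ _ _ ord0 i x.2)).
Qed.

Lemma coef_hull_between (l w : R -> coefs R m) (g : coefs R m -> R) (lo hi : R) :
  continuous g -> (forall t, lo <= g (l t) <= hi) -> coef_hull l w ->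
  forall s, lo <= g (w s) <= hi.
Proof.
move=> cg glo wl s.
pose F := [set x | lo <= x] `&` [set x | x <= hi].
have : (g @^-1` F) (w s); last by move=> [? ?]; apply/andP.
apply: (coef_hull_closed _ _ wl); last by move=> t; apply/andP.
apply: closed_comp => //; apply: closedI; [exact: closed_ge|exact: closed_le].
Qed.

Lemma coef_hull_continuous (l w : R -> coefs R m) (g : coefs R m -> R) :
  continuous g -> coef_hull l w -> continuous (fun t => g (shift_flow w t 0)).
Proof.
move=> cg [cw _] t; rewrite /shift_flow.
have -> : (fun t => g (w (t + 0))) = g \o w by apply/funext => s /=; rewrite addr0.
exact: (continuous_comp (cw t) (@cg (w t))).
Qed.

End HullCoefs.

(** * Finite families and continuity on segments *)

Lemma fin_pos_lower_bound (R : realType) (m : nat) (e : 'I_m -> R) :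
  (forall i, 0 < e i) -> exists2 e0 : R, 0 < e0 & forall i, e0 <= e i.
Proof.
(* The starting value [1] keeps the minimum positive even over an empty family. *)
move=> epos; exists (\big[Num.min/1]_i e i); first exact: lt_bigmin.
by move=> i; exact: bigmin_le.
Qed.

Lemma continuous_sum_ord (R : realType) (m : nat) (f : 'I_m -> R -> R) :
  (forall j, continuous (f j)) -> continuous (fun t => \sum_j f j t).
Proof.
move=> cf; elim: (index_enum _) => [|j s IH].
  by under eq_fun do rewrite big_nil; move=> t; exact: cvg_cst.
under eq_fun do rewrite big_cons.
by move=> t; apply: cvgD; [exact: cf|exact: IH].
Qed.

(** The argument of [f] is the projection of [t] onto [[- a, 0]]. It turns a history known on its
    segment into a continuous function on the line, constant after [0], as the iteration
    requires. *)
Lemma continuous_clamp (R : realType) (f : R -> R) (a : R) : 0 <= a ->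
  {within `[- a, 0], continuous f} ->
  continuous (fun t : R => f (Num.max (Num.min t 0 + a) 0 - a)).
Proof.
move=> a0 /subspace_continuousP cf t.
pose c (s : R) : R := Num.max (Num.min s 0 + a) 0 - a.
have c_in s : `[- a, 0]%classic (c s).
  rewrite /= in_itv/= /c; apply/andP; split.
    by rewrite lerBrDr addNr le_max lexx orbT.
  by rewrite subr_le0 ge_max a0 andbT gerDr ge_min lexx orbT.
have cc : {for t, continuous c}.
  apply: cvgB; last exact: cvg_cst.
  have h : {for t, continuous (fun s : R => Num.min s 0 + a)}.
    have h1 : Num.min s 0 @[s --> t] --> Num.min t 0 by exact: continuous_min0.
    exact: cvgD h1 (cvg_cst a).
  exact: (continuous_comp h (@continuous_max0 R _)).
move=> B /(cf _ (c_in t)) HB.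
have HB' : nbhs t [set s | `[- a, 0]%classic (c s) -> B (f (c s))] by exact: cc HB.
by apply: filterS HB' => s /(_ (c_in s)).
Qed.

Lemma continuous_within_bounded (R : realType) (f : R -> R) (a b : R) :
  {within `[a, b], continuous f} ->
  exists M, forall t, a <= t <= b -> `|f t| <= M.
Proof.
move=> cf; have := compact_bounded (continuous_compact cf (@segment_compact _ a b)).
move=> [M [_ HM]]; exists (M + 1) => t tab.
by apply: (HM (M + 1) _ (f t)); rewrite ?ltrDl//; exists t => //=; rewrite in_itv.
Qed.

(** * Lipschitz histories and the interior of the cone *)

Section LipschitzHistories.
Variables (R : realType) (m : nat) (r : 'I_m -> R).
Hypothesis r_gt0 : forall i, 0 < r i.

Lemma continuous_norm_le phi : inX r phi ->
  exists2 M, 0 <= M & forall i s, - r i <= s <= 0 -> `|phi i s| <= M.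
Proof.
move=> cphi; have /choice[M HM] : forall i, exists M, forall s,
    - r i <= s <= 0 -> `|phi i s| <= M.
  by move=> i; exact: continuous_within_bounded.
have M0 i : 0 <= M i by apply: le_trans (HM i 0 _); rewrite // lexx oppr_le0 ltW.
exists (\sum_i M i); first exact: sumr_ge0.
move=> i s /HM/le_trans; apply; rewrite (bigD1 i)//= lerDl; exact: sumr_ge0.
Qed.

(** Summing the Lipschitz constants of the components gives a single explicit one, easier to combine
    than the formulation by large enough constants. *)
Lemma XLP (f : hist R m) : XL r f <->
  exists2 k, 0 <= k & forall i s t, - r i <= s <= 0 -> - r i <= t <= 0 ->
    `|f i t - f i s| <= k * `|t - s|.
Proof.
split=> [Lf|[k k0 fk] i].
  have /choice[k kP] : forall i, exists k, 0 <= k /\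
      forall s t, - r i <= s <= 0 -> - r i <= t <= 0 -> `|f i t - f i s| <= k * `|t - s|.
    move=> i; have /pinfty_ex_gt0[k k0 fk] := Lf i; exists k; split; first exact: ltW.
    move=> s t sr tr; apply: (fk (t, s)); split => /=; by rewrite in_itv.
  exists (\sum_i k i); first by apply: sumr_ge0 => i _; have [] := kP i.
  move=> i s t sr tr; have [_ /(_ s t sr tr)/le_trans] := kP i; apply.
  rewrite ler_wpM2r// (bigD1 i)//= lerDl; apply: sumr_ge0 => j _.
  by have [] := kP j.
have r0 : - r i <= (0 : R) <= 0 by rewrite oppr_le0 (ltW (r_gt0 i)) lexx.
apply: (@klipschitzW _ _ _ k).
  by apply: (@globally_properfilter _ _ (0, 0)); split; rewrite /= in_itv.
by move=> [s t] [/= sr tr]; apply: fk; [move: tr|move: sr]; rewrite in_itv.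
Qed.

Lemma XL_inX (f : hist R m) : XL r f -> inX r f.
Proof.
move=> /XLP[k k0 fk] i; apply/subspace_continuousP => s /=; rewrite in_itv/= => sr.
apply/cvgrPdist_lt => e e0.
have k1 : 0 < k + 1 by rewrite ltr_wpDl.
have : \forall t \near s, `|s - t| < e / (k + 1).
  have : t @[t --> s] --> s by exact: cvg_id.
  by move=> /cvgrPdist_lt; apply; rewrite divr_gt0.
apply: filterS => t st; rewrite /= in_itv/= => tr.
apply: le_lt_trans (fk i t s tr sr) _.
move: st; rewrite ltr_pdivlMr// mulrC; apply: le_lt_trans.
by rewrite ler_wpM2r// lerDl.
Qed.

Lemma XL_hsub (f g : hist R m) : XL r f -> XL r g -> XL r (hsub f g).
Proof.
move=> /XLP[k k0 fk] /XLP[l l0 gl]; apply/XLP; exists (k + l); first exact: addr_ge0.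
move=> i s t sr tr; rewrite mulrDl.
have -> : hsub f g i t - hsub f g i s = (f i t - f i s) - (g i t - g i s).
  by rewrite /hsub; ring.
by rewrite (le_trans (ler_normB _ _))// lerD// ?fk ?gl.
Qed.

Lemma normr_le_Xnorm (f : hist R m) i s : inX r f -> - r i <= s <= 0 ->
  `|f i s| <= Xnorm r f.
Proof.
move=> cf sr; have [M _ fM] := continuous_norm_le cf.
apply: ub_le_sup; last by exists i, s.
by exists M => _ [j [t [tr ->]]]; exact: fM.
Qed.

(** A supremum is an upper bound only of a set bounded above; the constant from [XLP] bounds the
    difference quotients. *)
Lemma slope_le_lip_const (f : hist R m) i s t : XL r f ->
  - r i <= s -> s <= t -> t <= 0 ->
  `|f i t - f i s| <= lip_const r f * (t - s).
Proof.
move=> /XLP[k k0 fk] rs; rewrite le_eqVlt => /predU1P[->|st] t0.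
  by rewrite !subrr normr0 mulr0.
rewrite -ler_pdivrMr ?subr_gt0//; apply: ub_le_sup; last by exists i, s, t.
exists k => _ [j [s' [t' [rs' st' t0' ->]]]].
rewrite ler_pdivrMr ?subr_gt0// -[t' - s']gtr0_norm ?subr_gt0//.
by apply: fk; rewrite ?rs' ?t0' ?(le_trans (ltW st') t0') ?(le_trans rs' (ltW st')).
Qed.

Lemma Xnorm_ge0 (f : hist R m) (i : 'I_m) : inX r f -> 0 <= Xnorm r f.
Proof.
move=> cf; apply: le_trans (normr_le_Xnorm (i := i) (s := 0) cf _) => //.
by rewrite lexx oppr_le0 ltW.
Qed.

Lemma lip_const_ge0 (f : hist R m) (i : 'I_m) : XL r f -> 0 <= lip_const r f.
Proof.
move=> Lf; have r0 := r_gt0 i.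
have r0' : - r i <= 0 by rewrite oppr_le0 ltW.
have := slope_le_lip_const Lf (lexx _) r0' (lexx _).
by rewrite sub0r opprK => /(le_trans (normr_ge0 _)); rewrite pmulr_lge0.
Qed.

Lemma expR_slope_le (k s t : R) : 0 <= k -> s <= t -> t <= 0 ->
  `|expR (k * t) - expR (k * s)| <= k * (t - s).
Proof.
move=> k0 st t0; have ks : k * s <= k * t by rewrite ler_wpM2l.
rewrite ger0_norm ?subr_ge0 ?ler_expR//.
have -> : k * s = k * t + k * (s - t) by ring.
rewrite expRD; have := expR_ge1Dx (k * (s - t)).
have : expR (k * t) <= 1 by rewrite -expR0 ler_expR mulr_ge0_le0.
have := expR_gt0 (k * t).
have : 0 <= k * (t - s) by rewrite mulr_ge0// subr_ge0.
have -> : k * (t - s) = - (k * (s - t)) by ring.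
by set u := k * (s - t); set E := expR (k * t); set F := expR u; nra.
Qed.

Lemma continuous_hist_seg (f : hist R m) T :
  (forall i, {within `[T - r i, T], continuous (f i)}) -> inX r (hist_seg f T).
Proof.
move=> cf i; apply/subspace_continuousP => s /=; rewrite in_itv/= => /andP[rs s0].
have /subspace_continuousP/(_ (T + s)) := cf i.
have Ts u : - r i <= u -> u <= 0 -> `[T - r i, T]%classic (T + u).
  by move=> ru u0; rewrite /= in_itv/= lerD2l ru/= gerDl.
move=> /(_ (Ts _ rs s0)) fT B /fT HB.
have HB' : \forall t \near T + s, `[T - r i, T]%classic t -> B (f i t) by exact: HB.
have cs : T + u @[u --> s] --> T + s by apply: cvgD; [exact: cvg_cst|exact: cvg_id].
have : \forall u \near s, `[T - r i, T]%classic (T + u) -> B (f i (T + u)).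
  exact: cs HB'.
apply: filterS => u Bu; rewrite /= in_itv/= => /andP[ru u0]; apply: Bu; exact: Ts.
Qed.

(** The weights may be read in absolute time: a shift by [T] multiplies both sides by
    [expR (mu i * T)]. *)
Lemma KB_hist_seg (mu : 'I_m -> R) (f : hist R m) T :
  (forall i, {within `[T - r i, T], continuous (f i)}) ->
  (forall i t, T - r i <= t <= T -> 0 <= f i t) ->
  (forall i s t, T - r i <= s -> s <= t -> t <= T ->
    f i s * expR (mu i * s) <= f i t * expR (mu i * t)) ->
  KB r mu (hist_seg f T).
Proof.
move=> cf f0 mono; split; first exact: continuous_hist_seg.
  by move=> i s /andP[rs s0]; apply: f0; rewrite lerD2l rs gerDl.
move=> i s t rs st t0.
have := mono i (T + s) (T + t); rewrite !lerD2l gerDl => /(_ rs st t0).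
by rewrite !mulrDr !expRD !mulrA ![_ * expR (mu i * T) * _]mulrAC ler_pM2r ?expR_gt0.
Qed.

(** A uniform margin [e] for [f] and for [f' + mu * f], with a bound on [f'], gives both
    descriptions of the interior. Derivatives are asked for only before [T], where they are
    two-sided. *)
Lemma hist_seg_ggB0 (mu : 'I_m -> R) (f df : hist R m) (T e L : R) :
  (forall i, 0 <= mu i) -> 0 < e ->
  (forall i, {within `[T - r i, T], continuous (f i)}) ->
  (forall i t, T - r i <= t < T -> is_derive t 1 (f i) (df i t)) ->
  (forall i t, T - r i <= t < T -> `|df i t| <= L) ->
  (forall i t, T - r i <= t <= T -> e <= f i t) ->
  (forall i t, T - r i <= t < T -> e <= df i t + mu i * f i t) ->
  ggB0 r mu (hist_seg f T).
Proof.
move=> mu0 e0 cf dfE dfL fe slope.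
have cont_sub i s t : - r i <= s -> t <= 0 -> {within `[T + s, T + t], continuous (f i)}.
  move=> rs t0; apply: (continuous_subspaceW _ (cf i)).
  by apply: subset_itv; rewrite bnd_simp ?lerD2l// gerDl.
have in_seg i s t x : - r i <= s -> t <= 0 -> T + s < x < T + t -> T - r i <= x < T.
  by move=> rs t0 /andP[sx xt]; apply/andP; split; lra.
have Lf : XL r (hist_seg f T).
  apply/XLP; exists `|L| => // i.
  have main s t : - r i <= s -> s <= t -> t <= 0 ->
      `|hist_seg f T i t - hist_seg f T i s| <= `|L| * `|t - s|.
    move=> rs st t0; have Tst : T + s <= T + t by rewrite lerD2l.
    have dE x (h : T + s < x < T + t) := dfE i x (in_seg _ _ _ _ rs t0 h).
    have dL x : T + s < x < T + t -> `|df i x| <= `|L|.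
      by move=> /(in_seg _ _ _ _ rs t0)/dfL/le_trans; apply; exact: ler_norm.
    have := slope_ge (k := - `|L|) Tst (cont_sub _ _ _ rs t0) dE.
    have := slope_le (k := `|L|) Tst (cont_sub _ _ _ rs t0) dE.
    move=> /(_ (fun x h => le_trans (ler_norm _) (dL x h))) up.
    have lowd x : T + s < x < T + t -> - `|L| <= df i x.
      by move=> /dL; rewrite ler_norml => /andP[].
    move=> /(_ lowd) low.
    have ts : `|t - s| = T + t - (T + s) by rewrite ger0_norm ?subr_ge0//; ring.
    by rewrite ts ler_norml -mulNr low up.
  move=> s t /andP[rs s0] /andP[rt t0]; have [st|/ltW ts] := leP s t; first exact: main.
  by rewrite distrC (distrC t); exact: main.
split.
  split=> //.
  (* A perturbation of Lipschitz norm below [e1] changes the weighted history at rate at most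
     [e1 * (1 + mu i)], while the unperturbed one grows at rate at least
     [e * expR (- mu i * r i)]. *)
  have pos i : 0 < e * expR (- mu i * r i) / (1 + mu i).
    by rewrite divr_gt0 ?mulr_gt0 ?expR_gt0// ltr_pwDl.
  have [e1 e10 e1P] := fin_pos_lower_bound pos.
  exists e1 => // psi Lpsi small.
  pose eta := hsub psi (hist_seg f T).
  have Leta : XL r eta by exact: XL_hsub.
  have e1mu i : e1 * (1 + mu i) <= e * expR (- mu i * r i).
    by rewrite -ler_pdivlMr ?e1P// ltr_pwDl.
  have eta_le i s : - r i <= s <= 0 -> `|eta i s| <= e1.
    move=> sr; apply: le_trans (normr_le_Xnorm (XL_inX Leta) sr) _.
    by apply: le_trans (ltW small); rewrite lerDl lip_const_ge0.
  have eta_lip i s t : - r i <= s -> s <= t -> t <= 0 ->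
      `|eta i t - eta i s| <= e1 * (t - s).
    move=> rs st t0; apply: le_trans (slope_le_lip_const Leta rs st t0) _.
    rewrite ler_wpM2r ?subr_ge0//; apply: le_trans (ltW small).
    by rewrite lerDr (Xnorm_ge0 i (XL_inX Leta)).
  have psiE i s : psi i s = f i (T + s) + eta i s.
    by rewrite /eta /hsub /hist_seg addrC subrK.
  split; first exact: XL_inX.
    move=> i s sr.
    have e1e : e1 <= e.
      apply: (@le_trans _ _ (e1 * (1 + mu i))).
        by rewrite ler_peMr ?(ltW e10)// lerDl.
      apply: le_trans (e1mu i) _; rewrite ler_piMr ?(ltW e0)// -expR0 ler_expR.
      by rewrite mulNr oppr_le0 mulr_ge0// ltW.
    have := eta_le i s sr; rewrite ler_norml => /andP[lo _].
    have : e <= f i (T + s).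
      by apply: fe; have /andP[rs s0] := sr; rewrite lerD2l rs gerDl.
    by rewrite psiE /hist0; lra.
  move=> i s t rs st t0; rewrite !psiE.
  have Tst : T + s <= T + t by rewrite lerD2l.
  (* The factor [expR (- mu i * T)] turns the weight in absolute time into the weight of the
     segment, equal to 1 at [T]. *)
  pose g x := f i x * expR (mu i * x) * expR (- mu i * T).
  pose dg x := (df i x + mu i * f i x) * expR (mu i * x) * expR (- mu i * T).
  have dgE x : T + s < x < T + t -> is_derive x 1 g (dg x).
    move=> h; have := is_derive_mul_expR (mu i) (dfE i x (in_seg _ _ _ _ rs t0 h)).
    move=> /(@is_deriveM _ _ _ _ _ _ _ _)/(_ (is_derive_cst (expR (- mu i * T)) _ _)).
    rewrite scaler0 add0r /GRing.scale/= => H; apply: (is_derive_eq H).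
    by rewrite /dg /cst mulrC.
  have cg : {within `[T + s, T + t], continuous g}.
    move=> x; apply: cvgM; last exact: cvg_cst.
    exact: (continuous_mul_expR (cont_sub _ _ _ rs t0)).
  have dg_ge x : T + s < x < T + t -> e1 * (1 + mu i) <= dg x.
    move=> h; apply: le_trans (e1mu i) _; rewrite /dg -mulrA -expRD.
    have hx := in_seg _ _ _ _ rs t0 h.
    apply: ler_pM; rewrite ?expR_ge0 ?(ltW e0)// ?slope// ler_expR.
    have -> : mu i * x + - mu i * T = mu i * (x - T) by ring.
    by rewrite mulNr -mulrN ler_wpM2l//; have /andP[] := hx; lra.
  have := slope_ge Tst cg dgE dg_ge.
  have gE u : g (T + u) = f i (T + u) * expR (mu i * u).
    by rewrite /g -mulrA -expRD; congr (_ * expR _); ring.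
  rewrite !gE.
  have -> : T + t - (T + s) = t - s by ring.
  (* The increment of the weighted [eta] splits into that of [eta] at the weight of [t] and that of
     the weight at [eta i s]. *)
  have et : `|(eta i t - eta i s) * expR (mu i * t)| <= e1 * (t - s).
    rewrite normrM (ger0_norm (expR_ge0 _)) -[leRHS]mulr1.
    apply: ler_pM; rewrite ?expR_ge0// ?eta_lip// -expR0 ler_expR.
    by rewrite mulr_ge0_le0.
  have es : `|eta i s * (expR (mu i * t) - expR (mu i * s))| <= e1 * (mu i * (t - s)).
    rewrite normrM ler_pM// ?eta_le ?rs ?(le_trans st t0)//.
    exact: expR_slope_le.
  by move: et es; rewrite !ler_norml => /andP[h1 _] /andP[h2 _] h3; nra.
split=> //.
  move=> i s /andP[rs s0]; apply: lt_le_trans e0 _.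
  by apply: fe; rewrite lerD2l rs gerDl.
(* The exceptional null set is the right end [0], where only a one-sided derivative is expected. *)
exists e => // i; exists [set (0 : R)]; split => //; first exact: lebesgue_measure_set1.
move=> s /= Hs; apply: contrapT => s_neq0; apply: Hs => /andP[rs s0].
have Ts : T - r i <= T + s < T.
  rewrite lerD2l rs/= gtrDl lt_neqAle s0 andbT; exact/eqP.
have d1 : is_derive s 1 (hist_seg f T i) (df i (T + s)).
  have ds : is_derive s 1 (fun u : R => T + u) (1 : R).
    by have := is_deriveD (is_derive_cst T s 1) (is_derive_id s 1); rewrite add0r.
  have := @is_derive1_comp _ (f i) (fun u => T + u) s _ _ (dfE i _ Ts) ds.
  by rewrite mulr1.
split; first by have [] := d1.
by rewrite derive1E (@derive_val _ _ _ _ _ _ _ d1); exact: slope.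
Qed.

End LipschitzHistories.

(** * The system along one orbit of the hull: positivity and existence *)

Section Nicholson.
Variables (R : realType) (m : nat) (r : 'I_m -> R) (w : R -> coefs R m).
Variables (dp bp : 'I_m -> R) (ap : 'I_m -> 'I_m -> R).

Local Notation D i t := (dOf (shift_flow w t) i).
Local Notation A i j t := (aOf (shift_flow w t) i j).
Local Notation Be i t := (betaOf (shift_flow w t) i).
Local Notation C i t := (cOf (shift_flow w t) i).

Hypothesis r_gt0 : forall i, 0 < r i.
Hypothesis D_bnd : forall i t, 0 <= D i t <= dp i.
Hypothesis A_bnd : forall i j t, 0 <= A i j t <= ap i j.
Hypothesis B_bnd : forall i t, 0 <= Be i t <= bp i.
Hypothesis C_ge0 : forall i t, 0 <= C i t.

Local Notation rhs y i t :=
  (nicholsonF r (shift_flow w t) (hist_seg y t) i ord0).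

Lemma nicholsonF_segE (y : hist R m) i t : rhs y i t =
  - D i t * y i t + \sum_j A i j t * y j t
  + Be i t * (y i (t - r i) * expR (- C i t * y i (t - r i))).
Proof. by rewrite mxE /hist_seg addr0 mulrA. Qed.

(** At an interior time small increments satisfy [0 <= t + h <= T] automatically, so the relative
    derivative is an ordinary one. *)
Lemma is_solution_derive phi T y : is_solution r w phi T y ->
  forall i t, 0 < t < T -> is_derive t 1 (y i) (rhs y i t).
Proof.
move=> [_ _ dy] i t /andP[t0 tT].
have {}dy := dy i t; rewrite !ltW// in dy.
have cv : (fun h : R => h^-1 *: ((y i \o shift t) (h *: 1) - y i t)) @ 0^' --> rhs y i t.
  move=> B /(dy isT) HB.
  have near0 : \forall h \near 0^', 0 <= t + h <= T.
    have e0 : 0 < Num.min t (T - t) by rewrite lt_min t0 subr_gt0.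
    exists (Num.min t (T - t)) => //= h hB _.
    have {hB} : `|0 - h| < Num.min t (T - t) by [].
    by rewrite sub0r normrN lt_min !ltr_norml => /andP[/andP[? ?] /andP[? ?]]; lra.
  have HB' : \forall h \near 0^', 0 <= t + h <= T -> B (h^-1 * (y i (t + h) - y i t)).
    exact: HB.
  apply: filterS2 near0 HB' => h hT /(_ hT) /=.
  by rewrite /GRing.scale/= mulr1 (addrC h).
by apply: DeriveDef; [apply/cvg_ex; exists (rhs y i t)|exact: cvg_lim cv].
Qed.

Lemma is_solution_cont phi T y a b : is_solution r w phi T y ->
  forall i, - r i <= a -> b <= T -> {within `[a, b], continuous (y i)}.
Proof.
move=> [_ cy _] i ra bT; apply: (continuous_subspaceW _ (cy i)).
by apply: subset_itv; rewrite bnd_simp.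
Qed.

Lemma exists_step : exists2 rho, 0 < rho & forall i, rho <= r i.
Proof. exact: fin_pos_lower_bound. Qed.

(** Summing over all rows gives a constant common to the components, as [kamke_ge0] demands. *)
Lemma row_sum_le k x : \sum_j A k j x <= \sum_i \sum_j ap i j.
Proof.
rewrite [leRHS](bigD1 k)//= -[leLHS]addr0 lerD//.
  by apply: ler_sum => j _; have /andP[] := A_bnd k j x.
apply: sumr_ge0 => i _; apply: sumr_ge0 => j _.
by have /andP[a0 aa] := A_bnd i j x; exact: le_trans aa.
Qed.

(** Over a step no longer than the smallest delay the delayed terms are already nonnegative; what
    remains is a cooperative linear inequality, to which Kamke's comparison applies. *)
Lemma solution_ge0 phi T y : Xle r (@hist0 R m) phi -> is_solution r w phi T y ->
  forall i t, - r i <= t <= T -> 0 <= y i t.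
Proof.
move=> phi0 sy; have [rho rho0 rhor] := exists_step.
have y_init i s : - r i <= s <= 0 -> 0 <= y i s.
  by move=> sr; have [-> // _ _] := sy; exact: phi0.
move=> i t /andP[rt tT]; have [t0|t0] := leP t 0; first by rewrite y_init// rt.
apply: (step_ind (P := fun T' => forall i s, - r i <= s <= T' -> 0 <= y i s)
  rho0 _ _ (t := t) (T := T)) => //; last 2 first.
- by rewrite (ltW t0).
- by rewrite rt lexx.
move=> a b a0 ab brho bT IH j s /andP[rs sb].
have [sa|/ltW sa] := leP s a; first by rewrite IH// rs.
have ra k : - r k <= a by rewrite (le_trans _ a0)// oppr_le0 ltW.
apply: (@kamke_ge0 _ _ y (fun i t => rhs y i t) (fun i t => - D i t)
  (fun i j t => A i j t) (\sum_i \sum_j ap i j) a b) => //.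
- by move=> k; exact: (is_solution_cont sy).
- move=> k x /andP[ax xb]; apply: (is_solution_derive sy).
  by rewrite (le_lt_trans a0 ax) (lt_le_trans xb).
- by move=> k l x _; have /andP[] := A_bnd k l x.
- move=> k x _; have := row_sum_le k x; have /andP[] := D_bnd k x.
  by move=> ? _ ?; lra.
- move=> k x /andP[ax xb]; rewrite nicholsonF_segE lerDl.
  have /andP[b0 _] := B_bnd k x.
  rewrite mulr_ge0// mulr_ge0 ?expR_ge0// IH//.
  have := rhor k; have := r_gt0 k; lra.
- by move=> k; rewrite IH// ra lexx.
- by rewrite sa.
Qed.

(* The Picard operator of the system whose delayed argument is truncated at [0],
   which makes it globally Lipschitz; its solutions are nonnegative, so they also
   solve the original system. *)
Let G (i : 'I_m) (y : hist R m) (t : R) : R :=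
  - D i t * y i t + \sum_j A i j t * y j t
  + Be i t * (Num.max (y i (t - r i)) 0 * expR (- C i t * Num.max (y i (t - r i)) 0)).

Let K : R := 1 + \sum_i (dp i + \sum_j ap i j + bp i).

Let dp_ge0 i : 0 <= dp i. Proof. by have /andP[/le_trans] := D_bnd i 0; exact. Qed.
Let bp_ge0 i : 0 <= bp i. Proof. by have /andP[/le_trans] := B_bnd i 0; exact. Qed.
Let ap_ge0 i j : 0 <= ap i j. Proof. by have /andP[/le_trans] := A_bnd i j 0; exact. Qed.

Let row_ge0 i : 0 <= dp i + \sum_j ap i j + bp i.
Proof. by rewrite !addr_ge0// sumr_ge0. Qed.

Let K_ge1 : 1 <= K.
Proof. by rewrite lerDl sumr_ge0. Qed.

Let G_lip (y z : hist R m) (t e : R) : 0 <= t ->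
  (forall j s, s <= t -> `|y j s - z j s| <= e) ->
  forall i, `|G i y t - G i z t| <= K * e.
Proof.
move=> t0 yz i; have e0 : 0 <= e by rewrite (le_trans _ (yz i t (lexx t))).
have tr : t - r i <= t by rewrite gerBl ltW.
have -> : G i y t - G i z t = - D i t * (y i t - z i t)
    + \sum_j A i j t * (y j t - z j t)
    + Be i t * (Num.max (y i (t - r i)) 0 * expR (- C i t * Num.max (y i (t - r i)) 0)
      - Num.max (z i (t - r i)) 0 * expR (- C i t * Num.max (z i (t - r i)) 0)).
  have -> : \sum_j A i j t * (y j t - z j t)
      = \sum_j A i j t * y j t - \sum_j A i j t * z j t.
    by rewrite -sumrB; apply: eq_bigr => j _; rewrite mulrBr.
  by rewrite /G; ring.
apply: (@le_trans _ _ ((dp i + \sum_j ap i j + bp i) * e)); last first.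
  rewrite ler_wpM2r// -[leLHS]add0r lerD// [leRHS](bigD1 i)//= lerDl.
  exact: sumr_ge0.
rewrite !mulrDl (le_trans (ler_normD _ _))// lerD//.
  rewrite (le_trans (ler_normD _ _))// lerD//.
    have /andP[d0 dd] := D_bnd i t.
    by rewrite normrM normrN (ger0_norm d0) ler_pM// yz.
  rewrite mulr_suml (le_trans (ler_norm_sum _ _ _))// ler_sum// => j _.
  have /andP[a0 aa] := A_bnd i j t.
  by rewrite normrM (ger0_norm a0) ler_pM// yz.
have /andP[b0 bb] := B_bnd i t.
rewrite normrM (ger0_norm b0) ler_pM//.
rewrite (le_trans (ricker_lip (C_ge0 i t) _ _))//; try by rewrite le_max lexx orbT.
by rewrite (le_trans (dist_max0 _ _))// yz.
Qed.

Hypothesis D_cont : forall i, continuous (fun t => D i t).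
Hypothesis A_cont : forall i j, continuous (fun t => A i j t).
Hypothesis B_cont : forall i, continuous (fun t => Be i t).
Hypothesis C_cont : forall i, continuous (fun t => C i t).

Let G_cont (y : hist R m) : (forall i, continuous (y i)) ->
  forall i, continuous (G i y).
Proof.
move=> cy i.
have c1 : continuous (fun t => \sum_j A i j t * y j t).
  by apply: continuous_sum_ord => j t; apply: cvgM; [exact: A_cont|exact: cy].
have c2 : continuous (fun t => Num.max (y i (t - r i)) 0).
  move=> t; have h1 : {for t, continuous (fun s : R => s - r i)}.
    by apply: cvgB; [exact: cvg_id|exact: cvg_cst].
  have h2 := continuous_comp h1 (@cy i (t - r i)).
  exact: (continuous_comp h2 (@continuous_max0 R _)).
have c3 : continuous (fun t => expR (- C i t * Num.max (y i (t - r i)) 0)).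
  move=> t; have h : {for t, continuous (fun s => - C i s * Num.max (y i (s - r i)) 0)}.
    by apply: cvgM; [apply: cvgN; exact: C_cont|exact: c2].
  exact: (continuous_comp h (@continuous_expR R _)).
move=> t; apply: cvgD; first apply: cvgD.
- by apply: cvgM; [apply: cvgN; exact: D_cont|exact: cy].
- exact: c1.
- by apply: cvgM; [exact: B_cont|apply: cvgM; [exact: c2|exact: c3]].
Qed.

Lemma solution_exists phi : inX r phi -> Xle r (@hist0 R m) phi ->
  exists y, forall T, 0 <= T -> is_solution r w phi T y.
Proof.
move=> cphi phi0; have [M M0 phiM] := continuous_norm_le r_gt0 cphi.
pose cl i (t : R) := Num.max (Num.min t 0 + r i) 0 - r i.
have cl_in i t : - r i <= cl i t <= 0.
  rewrite /cl; apply/andP; split.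
    by rewrite lerBrDr addNr le_max lexx orbT.
  by rewrite subr_le0 ge_max (ltW (r_gt0 i)) andbT gerDr ge_min lexx orbT.
have clE i t : - r i <= t <= 0 -> cl i t = t.
  by move=> /andP[rt t0]; rewrite /cl min_l// max_l ?addrK// -lerBlDr sub0r.
pose psi i (t : R) := phi i (cl i t).
have cpsi i : continuous (psi i).
  exact: (continuous_clamp (ltW (r_gt0 i)) (cphi i)).
have psi_cst i t : 0 <= t -> psi i t = psi i 0.
  by move=> t0; rewrite /psi /cl !min_r.
have Gpsi i t : 0 <= t -> `|G i psi t| <= K * M.
  move=> t0.
  (* Since [G] vanishes at zero, its Lipschitz bound also bounds its size along the clamped
     history. *)
  have G0 : G i (@hist0 R m) t = 0.
    rewrite /G /hist0 maxxx mulr0 mul0r mulr0 addr0 add0r.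
    by apply: big1 => j _; rewrite mulr0.
  have := @G_lip psi (@hist0 R m) t M t0 _ i; rewrite G0 subr0; apply => j s _.
  by rewrite subr0; exact: phiM.
have [y [cy y_init yp]] :=
  @picard R m G psi K (K * M) K_ge1 cpsi G_cont G_lip Gpsi psi_cst.
have y_phi i s : - r i <= s <= 0 -> y i s = phi i s.
  by move=> rs; rewrite y_init ?(andP rs).2// /psi clE.
(* The truncation makes the delayed term nonnegative outright, so Kamke's comparison covers [[0, t]]
   in one go. *)
have y0 i t : - r i <= t -> 0 <= y i t.
  move=> rt; have [t0|t0] := leP t 0.
    by rewrite y_phi ?rt//; apply: phi0; rewrite rt.
  have cyT j : {within `[0, t], continuous (y j)} by exact: continuous_subspaceT.
  apply: (@kamke_ge0 _ _ y (fun i t => G i y t) (fun i t => - D i t)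
    (fun i j t => A i j t) (\sum_i \sum_j ap i j) 0 t) => //.
  - move=> k x /andP[x0 xt]; have [p yE dp'] := yp k.
    apply: near_eq_is_derive (dp' _ (ltW x0)).
    have : s @[s --> x] --> x by exact: cvg_id.
    by move=> /cvgr_ge/(_ _ x0); apply: filterS => s s0; rewrite yE.
  - by move=> k l x _; have /andP[] := A_bnd k l x.
  - move=> k x _; have := row_sum_le k x; have /andP[] := D_bnd k x.
    by move=> ? _ ?; lra.
  - move=> k x /andP[ax xb]; rewrite lerDl.
    have /andP[b0 _] := B_bnd k x.
    by rewrite mulr_ge0// mulr_ge0 ?expR_ge0// le_max lexx orbT.
  - move=> k; rewrite y_phi ?phi0// ?lexx ?andbT oppr_le0 ltW//.
  - by rewrite (ltW t0) lexx.
exists y => T T0; split => //.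
  by move=> i; exact: continuous_subspaceT.
move=> i t /andP[t0 tT]; have [p yE dp'] := yp i.
have -> : rhs y i t = G i y t.
  rewrite nicholsonF_segE /G max_l// y0// lerBrDr addNr//.
(* Increments with [0 <= t + h] see [y] and [p] agree, so the two-sided derivative of [p] yields the
   relative one of [y], also at [0]. *)
have [pd pE] := dp' _ t0; rewrite -pE => B HB.
have HB' : \forall h \near 0^', B (h^-1 *: (p (h *: 1 + t) - p t)) by exact: pd HB.
suff : \forall h \near 0^', 0 <= t + h <= T -> B (h^-1 * (y i (t + h) - y i t)) by [].
apply: filterS HB' => h; rewrite /GRing.scale/= mulr1 => HBh /andP[th _].
by rewrite !yE// (addrC t).
Unshelve. all: by end_near. Qed.

(** * Monotonicity for the exponential order *)

Lemma diag_mulE (mu : 'I_m -> R) (v : 'cV[R]_m) i :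
  (Bmx mu *m v) i ord0 = - mu i * v i ord0.
Proof. by rewrite /Bmx mul_diag_mx !mxE. Qed.

(** The linear terms are carried over exactly; only the delayed one is estimated, by the slope bound
    [- expR (- 2)]. *)
Lemma nicholsonF_sub_ge (phi psi : hist R m) i t :
  phi i (- r i) <= psi i (- r i) ->
  - D i t * (psi i 0 - phi i 0) + \sum_j A i j t * (psi j 0 - phi j 0)
    - Be i t * expR (- 2) * (psi i (- r i) - phi i (- r i)) <=
  nicholsonF r (shift_flow w t) psi i ord0 - nicholsonF r (shift_flow w t) phi i ord0.
Proof.
move=> le_r; have /andP[b0 _] := B_bnd i t.
have := ler_wpM2l b0 (ricker_slope_ge (C_ge0 i t) le_r).
have -> : \sum_j A i j t * (psi j 0 - phi j 0)
    = \sum_j A i j t * psi j 0 - \sum_j A i j t * phi j 0.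
  by rewrite -sumrB; apply: eq_bigr => j _; rewrite mulrBr.
by rewrite !mxE; lra.
Qed.

Section Weighted.
Variable mu : 'I_m -> R.
Hypothesis mu_ge0 : forall i, 0 <= mu i.
Hypothesis mu_ge : forall i, dp i + (r i)^-1 <= mu i.
Hypothesis bp_mu : forall i, bp i * expR (- 2) * expR (mu i * r i) <= (r i)^-1.

(** The order bounds the gap at [- r i] by [expR (mu i * r i)] times the gap at [0], so by [bp_mu]
    the delayed term loses at most that gap over [r i]. The constant is not weakened to [mu i], so
    that a strict smallness condition gives a strict inequality. *)
Lemma nicholsonF_quasimonotone phi psi t i : leB r mu phi psi ->
  - (dp i + (r i)^-1) * (psi i 0 - phi i 0) <=
  nicholsonF r (shift_flow w t) psi i ord0 - nicholsonF r (shift_flow w t) phi i ord0.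
Proof.
move=> [_ d0 mono]; have rle k : - r k <= 0 by rewrite oppr_le0 ltW.
have delta0 k : 0 <= psi k 0 - phi k 0 by apply: d0; rewrite rle lexx.
have deltar : 0 <= psi i (- r i) - phi i (- r i) by apply: d0; rewrite rle lexx.
have := @nicholsonF_sub_ge phi psi i t; rewrite -subr_ge0 => /(_ deltar).
have /andP[D0 Dd] := D_bnd i t; have /andP[b0 bb] := B_bnd i t.
have sum0 : 0 <= \sum_j A i j t * (psi j 0 - phi j 0).
  by apply: sumr_ge0 => j _; have /andP[? _] := A_bnd i j t; exact: mulr_ge0.
have := mono i (- r i) 0 (lexx _) (rle i) (lexx _).
rewrite mulr0 expR0 mulr1 mulrN expRN ler_pdivrMr ?expR_gt0// => weighted.
have : Be i t * expR (- 2) * (psi i (- r i) - phi i (- r i)) <=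
    (r i)^-1 * (psi i 0 - phi i 0).
  apply: (@le_trans _ _ (bp i * expR (- 2) * ((psi i 0 - phi i 0) * expR (mu i * r i)))).
    by rewrite ler_pM// ?mulr_ge0 ?expR_ge0// ler_wpM2r ?expR_ge0.
  by have := ler_wpM2r (delta0 i) (bp_mu i); lra.
have : D i t * (psi i 0 - phi i 0) <= dp i * (psi i 0 - phi i 0) by rewrite ler_wpM2r.
by move: sum0; rewrite !mulNr mulrDl /hsub; lra.
Qed.

Lemma solution_mono phi psi T y z : leB r mu phi psi ->
  is_solution r w phi T y -> is_solution r w psi T z ->
  forall i s t, - r i <= s -> s <= t -> t <= T ->
    (z i s - y i s) * expR (mu i * s) <= (z i t - y i t) * expR (mu i * t).
Proof.
move=> [_ d0 mono] sy sz; have [rho rho0 rhor] := exists_step.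
pose W i s := (z i s - y i s) * expR (mu i * s).
have rle k : - r k <= 0 by rewrite oppr_le0 ltW.
have W_init i s t : - r i <= s -> s <= t -> t <= 0 -> W i s <= W i t.
  move=> rs st t0; have [yE _ _] := sy; have [zE _ _] := sz.
  rewrite /W !yE ?zE ?(le_trans rs st) ?t0 ?rs ?(le_trans st t0)//.
  exact: mono.
have W_r i : 0 <= W i (- r i).
  have [yE _ _] := sy; have [zE _ _] := sz.
  rewrite /W yE ?zE ?lexx ?rle// mulr_ge0 ?expR_ge0//.
  by apply: d0; rewrite lexx rle.
have main T' : 0 <= T' <= T ->
    forall i s s', - r i <= s -> s <= s' -> s' <= T' -> W i s <= W i s'.
  apply: (step_ind (P := fun b => forall i s s', - r i <= s -> s <= s' -> s' <= b ->
    W i s <= W i s') rho0) => //.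
  move=> a b a0 ab brho bT IH.
  have ra k : - r k <= a by rewrite (le_trans (rle k)).
  have Wa0 k : 0 <= W k a by rewrite (le_trans (W_r k))// IH// lexx.
  have cW i : {within `[a, b], continuous (W i)}.
    apply: continuous_mul_expR => x.
    by apply: cvgB; [exact: (is_solution_cont sz)|exact: (is_solution_cont sy)].
  pose dW i t := (rhs z i t - rhs y i t + mu i * (z i t - y i t)) * expR (mu i * t).
  have dWE i t : a < t < b -> is_derive t 1 (W i) (dW i t).
    move=> /andP[at_ tb].
    have tT : 0 < t < T by rewrite (le_lt_trans a0 at_) (lt_le_trans tb).
    apply: is_derive_mul_expR; apply: is_deriveB.
      exact: (is_solution_derive sz).
    exact: (is_solution_derive sy).
  (* Passing from the weight of component [j] to that of [i] puts this exponential into the coupling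
     and leaves it nonnegative. *)
  pose P i j t := A i j t * expR ((mu i - mu j) * t).
  have P0 i j t : a < t < b -> 0 <= P i j t.
    by move=> _; rewrite mulr_ge0 ?expR_ge0//; have /andP[] := A_bnd i j t.
  (* Since [t - r i <= a], the weighted delayed gap is at most [W i a], and [bp_mu] turns the loss
     into [W i a] over [r i]. *)
  have dW_ge i t : a < t < b ->
      (mu i - D i t) * W i t - (r i)^-1 * W i a + \sum_j P i j t * W j t <= dW i t.
    move=> /andP[at_ tb].
    have tra : - r i <= t - r i <= a.
      by have := rhor i; have := r_gt0 i; have := rhor i; lra.
    have /andP[tr1 tr2] := tra.
    have Wtr0 : 0 <= W i (t - r i) by rewrite (le_trans (W_r i))// IH.
    have Wtra : W i (t - r i) <= W i a by rewrite IH.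
    have dtr : hist_seg y t i (- r i) <= hist_seg z t i (- r i).
      by move: Wtr0; rewrite /W pmulr_lge0 ?expR_gt0// subr_ge0.
    have := ler_wpM2r (expR_ge0 (mu i * t)) (nicholsonF_sub_ge t dtr).
    rewrite /hist_seg addr0 => dF.
    have sumE : \sum_j P i j t * W j t =
        (\sum_j A i j t * (z j t - y j t)) * expR (mu i * t).
      rewrite mulr_suml; apply: eq_bigr => j _; rewrite /P /W.
      have -> : mu i * t = (mu i - mu j) * t + mu j * t by ring.
      by rewrite expRD; ring.
    have delay : Be i t * expR (- 2) * (z i (t - r i) - y i (t - r i)) * expR (mu i * t)
        <= (r i)^-1 * W i a.
      have -> : mu i * t = mu i * r i + mu i * (t - r i) by ring.
      rewrite expRD mulrACA -/(W i (t - r i)).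
      have /andP[b0 bb] := B_bnd i t.
      apply: ler_pM => //; first by rewrite !mulr_ge0 ?expR_ge0.
      apply: le_trans (bp_mu i).
      by rewrite !ler_wpM2r ?expR_ge0.
    move: dF delay; rewrite sumE /dW /W; nra.
  have muD i t : 0 <= mu i - D i t.
    have ri : 0 <= (r i)^-1 by rewrite invr_ge0 ltW.
    by have /andP[_ dd] := D_bnd i t; have := mu_ge i; lra.
  have muDr i t : (r i)^-1 <= mu i - D i t.
    by have /andP[_ dd] := D_bnd i t; have := mu_ge i; lra.
  have W_ge_a i t : a <= t <= b -> W i a <= W i t.
    move=> tab; rewrite -subr_ge0.
    (* For the constant, [(mu i - mu j) * t <= mu i * T] on [[0, T]]. Subtracting the values at [a]
       leaves the terms [(mu i - D i t - (r i)^-1) * W i a] and [P i j t * W j a], all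
       nonnegative. *)
    apply: (@kamke_ge0 _ _ (fun i t => W i t - W i a) dW (fun i t => mu i - D i t) P
      (\sum_i (mu i + \sum_j ap i j * expR (mu i * T))) a b) => //.
    - by move=> k x; apply: cvgB; [exact: cW|exact: cvg_cst].
    - move=> k x xab; rewrite -[dW k x]subr0.
      exact: is_deriveB (dWE k x xab) (is_derive_cst _ _ _).
    - move=> k x /andP[ax xb].
      have x0 : 0 <= x by rewrite (le_trans a0)// ltW.
      rewrite [leRHS](bigD1 k)//= -[leLHS]addr0 lerD//; last first.
        apply: sumr_ge0 => l _; rewrite addr_ge0// sumr_ge0// => l' _.
        have /andP[A0 Aa] := A_bnd l l' 0.
        by rewrite mulr_ge0 ?expR_ge0// (le_trans A0).
      rewrite lerD//; first by have /andP[D0 _] := D_bnd k x; rewrite gerBl.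
      apply: ler_sum => j _; have /andP[A0 Aa] := A_bnd k j x.
      rewrite ler_pM ?expR_ge0// ler_expR mulrBl.
      have xT : x <= T by rewrite (le_trans _ bT)// ltW.
      by have := ler_wpM2l (mu_ge0 k) xT; have := mulr_ge0 (mu_ge0 j) x0; lra.
    - move=> k x xab; apply: le_trans (dW_ge k x xab).
      have -> : \sum_j P k j x * (W j x - W j a)
          = \sum_j P k j x * W j x - \sum_j P k j x * W j a.
        by rewrite -sumrB; apply: eq_bigr => j _; rewrite mulrBr.
      have : 0 <= \sum_j P k j x * W j a.
        by apply: sumr_ge0 => j _; rewrite mulr_ge0// P0.
      have := ler_wpM2r (Wa0 k) (muDr k x); lra.
    - by move=> k; rewrite subrr.
  have dW0 i t : a < t < b -> 0 <= dW i t.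
    move=> tab; apply: le_trans (dW_ge i t tab).
    have sum0 : 0 <= \sum_j P i j t * W j t.
      apply: sumr_ge0 => j _; rewrite mulr_ge0 ?P0// (le_trans (Wa0 j))//.
      by apply: W_ge_a; case/andP: tab => /ltW-> /ltW->.
    have Wt : W i a <= W i t by apply: W_ge_a; case/andP: tab => /ltW-> /ltW->.
    have := ler_wpM2r (le_trans (Wa0 i) Wt) (muDr i t).
    have ri : 0 <= (r i)^-1 by rewrite invr_ge0 ltW.
    by have := ler_wpM2l ri Wt; lra.
  have W_ab i s s' : a <= s -> s <= s' -> s' <= b -> W i s <= W i s'.
    move=> as_ ss' s'b.
    have cs : {within `[s, s'], continuous (W i)}.
      by apply: (continuous_subspaceW _ (cW i)); apply: subset_itv; rewrite bnd_simp.
    have inab x : s < x < s' -> a < x < b.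
      by move=> /andP[sx xs]; rewrite (le_lt_trans as_ sx) (lt_le_trans xs).
    have := slope_ge (k := 0) ss' cs (fun x h => dWE i x (inab x h))
      (fun x h => dW0 i x (inab x h)).
    by rewrite mul0r subr_ge0.
  move=> i s s' rs ss' s'b.
  have [s'a|/ltW as'] := leP s' a; first exact: IH.
  have [sa|/ltW as_] := leP s a; last exact: W_ab.
  by rewrite (le_trans (IH i s a rs sa _))// W_ge_a// as'.
move=> i s t rs st tT; have [t0|t0] := leP t 0; first exact: W_init.
by apply: (main t) => //; rewrite (ltW t0).
Qed.

End Weighted.

(** * Nonnegative solutions entering the cone and its interior *)

Lemma solution_derive_ge phi T y : Xle r (@hist0 R m) phi ->
  is_solution r w phi T y ->
  forall i t, 0 < t < T -> - dp i * y i t <= rhs y i t.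
Proof.
move=> phi0 sy i t /andP[t0 tT]; have ri := r_gt0 i.
have y0 := solution_ge0 phi0 sy.
have rle k : - r k <= t by have := r_gt0 k; lra.
have yt k : 0 <= y k t by rewrite y0// rle ltW.
have ytr : 0 <= y i (t - r i) by apply: y0; lra.
rewrite nicholsonF_segE -[leLHS]addr0 lerD//; last first.
  by have /andP[? _] := B_bnd i t; rewrite !mulr_ge0 ?expR_ge0.
rewrite -[leLHS]addr0 lerD//.
  by have /andP[_ dd] := D_bnd i t; rewrite ler_wpM2r// lerN2.
by apply: sumr_ge0 => j _; have /andP[? _] := A_bnd i j t; exact: mulr_ge0.
Qed.

(** Provides the Lipschitz constant of the segments; by nonnegativity the exponential factor is at
    most 1. *)
Lemma solution_derive_bounded phi T y : inX r phi -> Xle r (@hist0 R m) phi ->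
  is_solution r w phi T y ->
  exists L, forall i t, 0 < t < T -> `|rhs y i t| <= L.
Proof.
move=> cphi phi0 sy; have y0 := solution_ge0 phi0 sy.
have /choice[M HM] : forall i, exists M, forall t, - r i <= t <= T -> `|y i t| <= M.
  by move=> i; apply: continuous_within_bounded; have [_ + _] := sy; apply.
pose b i := dp i * M i + \sum_j ap i j * M j + bp i * M i.
have yM k t : 0 < t < T -> 0 <= y k t <= M k.
  move=> /andP[t0 tT]; have rt : - r k <= t <= T by have := r_gt0 k; lra.
  by rewrite y0//= (le_trans (ler_norm _))// HM.
have ytrM k t : 0 < t < T -> 0 <= y k (t - r k) <= M k.
  move=> /andP[t0 tT]; have rt : - r k <= t - r k <= T by have := r_gt0 k; lra.
  by rewrite y0//= (le_trans (ler_norm _))// HM.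
have bound i t : 0 < t < T -> `|rhs y i t| <= b i.
  move=> tT; rewrite nicholsonF_segE.
  rewrite (le_trans (ler_normD _ _))// lerD//.
    rewrite (le_trans (ler_normD _ _))// lerD//.
      have /andP[? ?] := D_bnd i t; have /andP[? ?] := yM i t tT.
      by rewrite normrM normrN !ger0_norm// ler_pM.
    rewrite (le_trans (ler_norm_sum _ _ _))// ler_sum// => j _.
    have /andP[? ?] := A_bnd i j t; have /andP[? ?] := yM j t tT.
    by rewrite normrM !ger0_norm// ler_pM.
  have /andP[b0 bb] := B_bnd i t; have /andP[z0 zM] := ytrM i t tT.
  rewrite !normrM !ger0_norm ?expR_ge0// ler_pM ?mulr_ge0 ?expR_ge0//.
  rewrite -[leRHS]mulr1 ler_pM ?expR_ge0// -expR0 ler_expR mulNr oppr_le0.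
  exact: mulr_ge0.
exists (\sum_i `|b i|) => i t tT.
rewrite (le_trans (bound i t tT))// (le_trans (ler_norm _))// (bigD1 i)//= lerDl.
exact: sumr_ge0.
Qed.

(** From [y' >= - dp * y >= - mu * y]. The equation acts only from time [0], so a segment is sure to
    lie in the cone once a full delay has passed. *)
Lemma solution_weighted_mono mu phi T y : (forall i, dp i <= mu i) ->
  Xle r (@hist0 R m) phi -> is_solution r w phi T y ->
  forall i s t, 0 <= s -> s <= t -> t <= T ->
    y i s * expR (mu i * s) <= y i t * expR (mu i * t).
Proof.
move=> dp_le_mu phi0 sy i s t s0 st tT.
pose W x := y i x * expR (mu i * x).
have cW : {within `[s, t], continuous W}.
  apply: continuous_mul_expR; apply: (is_solution_cont sy) => //.
  by apply: le_trans s0; rewrite oppr_le0 ltW.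
have in0T x : s < x < t -> 0 < x < T.
  by move=> /andP[sx xt]; rewrite (le_lt_trans s0 sx) (lt_le_trans xt).
have dW x (h : s < x < t) :=
  is_derive_mul_expR (mu i) (is_solution_derive sy i (in0T x h)).
have dW0 x : s < x < t -> 0 <= (rhs y i x + mu i * y i x) * expR (mu i * x).
  move=> /in0T h; rewrite mulr_ge0 ?expR_ge0//.
  have := solution_derive_ge phi0 sy i h.
  have y0 : 0 <= y i x.
    apply: (solution_ge0 phi0 sy); case/andP: h => x0 xT.
    by have := r_gt0 i; lra.
  by have := ler_wpM2r y0 (dp_le_mu i); lra.
by have := slope_ge (k := 0) st cW dW dW0; rewrite mul0r subr_ge0.
Qed.

Lemma solution_KB mu phi T y : (forall i, dp i <= mu i) ->
  Xle r (@hist0 R m) phi -> is_solution r w phi T y -> (forall i, r i <= T) ->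
  KB r mu (hist_seg y T).
Proof.
move=> dp_le_mu phi0 sy rT; apply: KB_hist_seg => //.
- move=> i; apply: (is_solution_cont sy) => //.
  by have := rT i; have := r_gt0 i; lra.
- move=> i t /andP[Trt tT]; apply: (solution_ge0 phi0 sy).
  by have := rT i; have := r_gt0 i; lra.
- move=> i s t Trs st tT; apply: (solution_weighted_mono dp_le_mu phi0 sy) => //.
  by apply: le_trans Trs; rewrite subr_ge0.
Qed.

(** Weighted monotonicity propagates positivity at [0]: [y i] stays above
    [phi i 0 * expR (- mu i * T)], and [y' + mu * y >= (mu - dp) * y] inherits a positive margin. As
    [r i < T], the segment sits at positive times. *)
Lemma solution_ggB0 mu phi T y : (forall i, 0 <= mu i) ->
  (forall i, dp i < mu i) -> inX r phi -> Xle r (@hist0 R m) phi ->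
  (forall i, 0 < phi i 0) ->
  is_solution r w phi T y -> (forall i, r i < T) -> ggB0 r mu (hist_seg y T).
Proof.
move=> mu_ge0 dp_lt_mu cphi phi0 phi00 sy rT.
have dp_le_mu i : dp i <= mu i by exact: ltW.
have [L HL] := solution_derive_bounded cphi phi0 sy.
pose low i := phi i 0 * expR (- mu i * T).
have low0 i : 0 < low i by rewrite mulr_gt0 ?expR_gt0.
have y_low i t : 0 <= t <= T -> low i <= y i t.
  move=> /andP[t0 tT]; have := solution_weighted_mono dp_le_mu phi0 sy i (lexx 0) t0 tT.
  have -> : y i 0 = phi i 0 by have [-> //] := sy; rewrite lexx oppr_le0 ltW.
  rewrite mulr0 expR0 mulr1 => phi_le; rewrite /low mulNr expRN ler_pdivrMr ?expR_gt0//.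
  apply: le_trans phi_le _; rewrite ler_wpM2l ?ler_expR ?ler_wpM2l//.
  by apply: (solution_ge0 phi0 sy); have := r_gt0 i; lra.
have e_pos i : 0 < Num.min (low i) ((mu i - dp i) * low i).
  by rewrite lt_min low0 mulr_gt0 ?subr_gt0.
have [e e0 eP] := fin_pos_lower_bound e_pos.
have in0T i t : T - r i <= t < T -> 0 < t < T.
  by move=> /andP[Tt ->]; rewrite andbT (lt_le_trans _ Tt)// subr_gt0.
apply: (@hist_seg_ggB0 _ _ _ r_gt0 mu y (fun i t => rhs y i t) T e L) => //.
- move=> i; apply: (is_solution_cont sy) => //.
  by have := rT i; have := r_gt0 i; lra.
- by move=> i t /in0T; exact: (is_solution_derive sy).
- by move=> i t /in0T; exact: HL.
- move=> i t /andP[Tt tT]; apply: (@le_trans _ _ (low i)).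
    by apply: le_trans (eP i) _; rewrite ge_min lexx.
  by apply: y_low; rewrite tT andbT (le_trans _ Tt)// subr_ge0 ltW.
- move=> i t /in0T tT; apply: (@le_trans _ _ ((mu i - dp i) * low i)).
    by apply: le_trans (eP i) _; rewrite ge_min lexx orbT.
  have yl : low i <= y i t by apply: y_low; case/andP: tT => /ltW-> /ltW->.
  have := solution_derive_ge phi0 sy i tT.
  have : 0 <= mu i - dp i by rewrite subr_ge0.
  by move=> md; have := ler_wpM2l md yl; lra.
Qed.
End Nicholson.

(** * The exponents and the smallness condition *)

Section NicholsonMu.
Variables (R : realType) (m : nat) (r : 'I_m -> R) (beta : 'I_m -> R -> R).
Variables (i : 'I_m) (D : R).
Let b := sup (range (beta i)).
Hypotheses (r_gt0 : 0 < r i) (b_gt0 : 0 < b).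

Lemma expR_nicholson_mu : expR (nicholson_mu r beta i * r i) = expR 2 / (r i * b).
Proof.
by rewrite mulrAC mulVf ?gt_eqF// mul1r lnK// posrE divr_gt0 ?expR_gt0// mulr_gt0.
Qed.

(** Equality holds: the exponent is chosen so that the factors [expR 2] and [b] cancel. *)
Lemma nicholson_mu_delay :
  b * expR (- 2) * expR (nicholson_mu r beta i * r i) <= (r i)^-1.
Proof.
rewrite expR_nicholson_mu expRN le_eqVlt; apply/orP; left; apply/eqP.
by field; rewrite !gt_eqF ?expR_gt0.
Qed.

Let expR_split : expR ((D + (r i)^-1) * r i) = expR (D * r i) * expR 1.
Proof. by rewrite mulrDl mulVf ?gt_eqF// expRD. Qed.

Let expR2 : expR 2 = expR 1 * expR 1 :> R.
Proof. by rewrite -expRD. Qed.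

(** After multiplication by [r i] and exponentiation the claim reads [expR (D * r i) * expR 1 <=
    expR 2 / (r i * b)], which is the smallness condition. *)
Lemma nicholson_mu_ge :
  r i * b * expR (D * r i) <= expR 1 -> D + (r i)^-1 <= nicholson_mu r beta i.
Proof.
move=> small; rewrite -(ler_pM2r r_gt0) -ler_expR expR_nicholson_mu expR_split.
by rewrite ler_pdivlMr ?mulr_gt0// expR2 mulrAC ler_pM2r ?expR_gt0// mulrC.
Qed.

Lemma nicholson_mu_gt :
  r i * b * expR (D * r i) < expR 1 -> D + (r i)^-1 < nicholson_mu r beta i.
Proof.
move=> small; rewrite -(ltr_pM2r r_gt0) -ltr_expR expR_nicholson_mu expR_split.
by rewrite ltr_pdivlMr ?mulr_gt0// expR2 mulrAC ltr_pM2r ?expR_gt0// mulrC.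
Qed.

End NicholsonMu.

(** * Assembling the statements over the hull *)

Lemma leB_hist0 (R : realType) (m : nat) (r mu : 'I_m -> R) (f : hist R m) :
  leB r mu (@hist0 R m) f <-> KB r mu f.
Proof.
rewrite /leB; suff -> : hsub f (@hist0 R m) = f by [].
by apply/funext => i; apply/funext => s; rewrite /hsub /hist0 subr0.
Qed.

Unset Implicit Arguments.

Theorem theorem4p2 (R : realType) (m : nat) (r : 'I_m -> R)
  (d : 'I_m -> R -> R) (a : 'I_m -> 'I_m -> R -> R) (beta c : 'I_m -> R -> R)
  (d0 c0 : R)
  (hm : (0 < m)%N)
  (hr : forall i, 0 < r i)
  (a1 : [/\ forall i, almost_periodic (d i),
            forall i j, almost_periodic (a i j),
            forall i, almost_periodic (c i) &
            forall i, almost_periodic (beta i)])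
  (a2 : 0 < d0 /\ forall i t, d0 <= d i t)
  (a3 : (forall i j t, 0 <= a i j t) /\ (forall i t, a i i t = 0))
  (a4 : forall i t, 0 < beta i t)
  (a5 : 0 < c0 /\ forall i t, c0 <= c i t)
  (a6 : forall i t, 0 < d i t - \sum_(j < m) a j i t) :
  let Omega := coef_hull (nicholson_coefs d a beta c) in
  let dplus := fun i => sup (range (d i)) in
  let bplus := fun i => sup (range (beta i)) in
  let mu := nicholson_mu r beta in
  let B := Bmx mu in
  let rmax := \big[Num.max/0]_(i < m) r i in
  ((forall i, r i * bplus i * expR (dplus i * r i) <= expR 1) ->
    [/\ forall i, B i i < 0,
        forall w phi psi, Omega w -> inX r phi -> inX r psi ->
          leB r mu phi psi ->
          vle (B *m (at0 psi - at0 phi))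
              (nicholsonF r w psi - nicholsonF r w phi) &
        forall w phi psi, Omega w -> inX r phi -> inX r psi ->
          leB r mu phi psi ->
          forall t y z, 0 <= t ->
            is_solution r w phi t y -> is_solution r w psi t z ->
            leB r mu (hist_seg y t) (hist_seg z t)])
  /\
  ((forall i, r i * bplus i * expR (dplus i * r i) < expR 1) ->
    [/\ forall w phi psi, Omega w -> inX r phi -> inX r psi ->
          leB r mu phi psi -> Xlt r phi psi ->
          vlt (B *m (at0 psi - at0 phi))
              (nicholsonF r w psi - nicholsonF r w phi),
        forall w phi, Omega w -> inX r phi -> Xle r (@hist0 R m) phi ->
          forall t, rmax <= t ->
            (exists y, is_solution r w phi t y) /\
            forall y, is_solution r w phi t y ->
              leB r mu (@hist0 R m) (hist_seg y t) &
        forall w phi, Omega w -> inX r phi -> Xle r (@hist0 R m) phi ->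
          vlt 0 (at0 phi) ->
          forall t, 2 * rmax <= t ->
            (exists y, is_solution r w phi t y) /\
            forall y, is_solution r w phi t y ->
              ggB0 r mu (hist_seg y t)]).
Proof.
move=> Omega dplus bplus mu B rmax.
have [apd apa apc apb] := a1; have [d0_gt0 d_ge] := a2; have [a_ge0 _] := a3.
have [c0_gt0 c_ge] := a5.
pose aplus i j := sup (range (a i j)).
have D_bnd w : Omega w -> forall i t, 0 <= dOf (shift_flow w t) i <= dplus i.
  move=> Ow i t; apply: (coef_hull_between (@continuous_coef_d R m i) _ Ow) => s.
  by rewrite mxE almost_periodic_le_sup// andbT (le_trans (ltW d0_gt0)).
have A_bnd w : Omega w -> forall i j t, 0 <= aOf (shift_flow w t) i j <= aplus i j.
  move=> Ow i j t; apply: (coef_hull_between (@continuous_coef_a R m i j) _ Ow) => s.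
  by rewrite mxE almost_periodic_le_sup// a_ge0.
have B_bnd w : Omega w -> forall i t, 0 <= betaOf (shift_flow w t) i <= bplus i.
  move=> Ow i t; apply: (coef_hull_between (@continuous_coef_beta R m i) _ Ow) => s.
  by rewrite mxE almost_periodic_le_sup// ltW// a4.
have C_ge0 w : Omega w -> forall i t, 0 <= cOf (shift_flow w t) i.
  move=> Ow i t.
  suff /andP[] : 0 <= cOf (shift_flow w t) i <= sup (range (c i)) by [].
  apply: (coef_hull_between (@continuous_coef_c R m i) _ Ow) => s.
  by rewrite mxE almost_periodic_le_sup// andbT (le_trans (ltW c0_gt0)).
have bplus_gt0 i : 0 < bplus i.
  by apply: lt_le_trans (a4 i 0) _; exact: almost_periodic_le_sup.
have bp_mu i : bplus i * expR (- 2) * expR (mu i * r i) <= (r i)^-1.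
  exact: (nicholson_mu_delay (hr i) (bplus_gt0 i)).
have dplus_ge0 i : 0 <= dplus i.
  by apply: le_trans (almost_periodic_le_sup 0 (apd i)); rewrite (le_trans (ltW d0_gt0)).
have rV_gt0 i : 0 < (r i)^-1 by rewrite invr_gt0.
(* Reads the vector field at [w] as the one along its orbit at time [0]. *)
have shift0 (w : R -> coefs R m) : shift_flow w 0 = w.
  by apply/funext => s; rewrite /shift_flow add0r.
have at0E (phi psi : hist R m) i : (B *m (at0 psi - at0 phi)) i ord0
    = - mu i * (psi i 0 - phi i 0).
  by rewrite diag_mulE !mxE.
have delta0 phi psi i : leB r mu phi psi -> 0 <= psi i 0 - phi i 0.
  by move=> [_ /(_ i 0) + _]; rewrite lexx oppr_le0 ltW// => /(_ isT).
have quasi w phi psi i : Omega w -> leB r mu phi psi ->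
    - (dplus i + (r i)^-1) * (psi i 0 - phi i 0)
      <= (nicholsonF r w psi - nicholsonF r w phi) i ord0.
  move=> Ow le_phi; have subE (u v : 'cV[R]_m) : (u - v) i ord0 = u i ord0 - v i ord0.
    by rewrite !mxE.
  have := nicholsonF_quasimonotone hr (D_bnd w Ow) (A_bnd w Ow) (B_bnd w Ow)
    (C_ge0 w Ow) bp_mu 0 i le_phi.
  by rewrite shift0 subE.
have rmax_ge i : r i <= rmax by rewrite /rmax; exact: le_bigmax.
have sol_ex w phi : Omega w -> inX r phi -> Xle r (@hist0 R m) phi ->
    exists y, forall T, 0 <= T -> is_solution r w phi T y.
  move=> Ow; apply: (solution_exists hr (D_bnd w Ow) (A_bnd w Ow) (B_bnd w Ow)
    (C_ge0 w Ow)) => [i|i j|i|i].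
  - exact: (coef_hull_continuous (@continuous_coef_d R m i) Ow).
  - exact: (coef_hull_continuous (@continuous_coef_a R m i j) Ow).
  - exact: (coef_hull_continuous (@continuous_coef_beta R m i) Ow).
  - exact: (coef_hull_continuous (@continuous_coef_c R m i) Ow).
split=> small.
  have mu_ge i : dplus i + (r i)^-1 <= mu i.
    exact: (nicholson_mu_ge (hr i) (bplus_gt0 i) (small i)).
  have mu_gt0 i : 0 < mu i.
    by apply: lt_le_trans (mu_ge i); rewrite ltr_wpDl.
  split.
  - by move=> i; rewrite /B /Bmx !mxE eqxx mulr1n oppr_lt0.
  - move=> w phi psi Ow _ _ le_phi i; rewrite at0E.
    apply: le_trans (quasi w phi psi i Ow le_phi).
    by rewrite ler_wpM2r ?delta0// lerN2.
  - move=> w phi psi Ow cphi cpsi le_phi T y z T0 sy sz.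
    have mono := solution_mono hr (D_bnd w Ow) (A_bnd w Ow) (B_bnd w Ow) (C_ge0 w Ow)
      (fun i => ltW (mu_gt0 i)) mu_ge bp_mu le_phi sy sz.
    have rT i : - r i <= T - r i by rewrite lerDr.
    apply: (@KB_hist_seg _ _ _ mu (hsub z y) T).
    + move=> i x; apply: cvgB.
        exact: (is_solution_cont sz (rT i) (lexx T)).
      exact: (is_solution_cont sy (rT i) (lexx T)).
    (* The weighted gap is nondecreasing from [- r i], where the initial order makes it
       nonnegative. *)
    + move=> i t /andP[Tt tT].
      have rt := le_trans (rT i) Tt.
      have := mono i (- r i) t (lexx _) rt tT.
      have [[yE _ _] [zE _ _]] := (sy, sz).
      have r_in : - r i <= - r i <= 0 by rewrite lexx oppr_le0 ltW.
      have [_ /(_ i _ r_in) d_r _] := le_phi.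
      rewrite yE// zE// => /(le_trans (mulr_ge0 d_r (expR_ge0 _))).
      by rewrite pmulr_lge0 ?expR_gt0.
    + by move=> i s t Ts; apply: mono; exact: le_trans (rT i) Ts.
have mu_gt i : dplus i + (r i)^-1 < mu i.
  exact: (nicholson_mu_gt (hr i) (bplus_gt0 i) (small i)).
have mu_gtd i : dplus i < mu i by apply: lt_trans (mu_gt i); rewrite ltrDl.
split.
- move=> w phi psi Ow _ _ le_phi lt_phi i; rewrite at0E.
  (* Strictness comes from [dplus i + (r i)^-1 < mu i] together with a positive gap at [0]. *)
  apply: lt_le_trans (quasi w phi psi i Ow le_phi).
  rewrite ltr_pM2r ?ltrN2// subr_gt0; apply: lt_phi.
  by rewrite lexx oppr_le0 ltW.
- move=> w phi Ow cphi phi0 T rT.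
  have T0 : 0 <= T.
    by apply: le_trans rT; apply: le_trans (rmax_ge (Ordinal hm)); exact: ltW.
  split; first by have [y /(_ T T0) sy] := sol_ex w phi Ow cphi phi0; exists y.
  move=> y sy; apply/leB_hist0.
  apply: (solution_KB hr (D_bnd w Ow) (A_bnd w Ow) (B_bnd w Ow) _ phi0 sy) => i.
    exact: ltW.
  exact: le_trans rT.
- move=> w phi Ow cphi phi0 phi00 T rT.
  have rmax_gt0 : 0 < rmax by apply: lt_le_trans (rmax_ge (Ordinal hm)).
  (* The last segment then avoids time [0], where the solution may have a corner. *)
  have rmaxT : rmax < T by apply: lt_le_trans rT; rewrite mulr_natl mulr2n ltrDl.
  have T0 : 0 <= T by exact: ltW (lt_trans rmax_gt0 rmaxT).
  split; first by have [y /(_ T T0) sy] := sol_ex w phi Ow cphi phi0; exists y.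
  move=> y sy.
  apply: (solution_ggB0 hr (D_bnd w Ow) (A_bnd w Ow) (B_bnd w Ow) (C_ge0 w Ow) _ mu_gtd
    cphi phi0 _ sy) => i.
  + by rewrite (le_trans (dplus_ge0 i))// ltW.
  + by have := phi00 i; rewrite !mxE.
  + exact: le_lt_trans (rmax_ge i) rmaxT.
Qed.
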